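(* Let $(Z,d,\mu)$ be a compact, connected, Ahlfors regular metric measure space, and let $X$ be a hyperbolic filling of $Z$. Suppose there is a metric space $Y$ quasi-isometric to $X$ and a group $G\subseteq\operatorname{Iso}(Y)$ acting cocompactly on $Y$. Then $Q_w(Z)=Q_w'(Z)$. Moreover, if the infimum in the definition of $Q_w(Z)$ is attained, then the infimum in the definition of $Q_w'(Z)$ is attained.
   Context: A metric measure space $(Z,d,\mu)$ ($\mu$ Borel regular) is Ahlfors $Q$-regular if there are $c,C>0$ with $cr^Q\le\mu(B(z,r))\le Cr^Q$ for all $z\in Z$, $0<r\le\operatorname{diam}(Z)$, and Ahlfors regular if this holds for some $Q$. The metric is rescaled so that $\operatorname{diam}(Z)=1$. Hyperbolic filling $X=(V_X,E_X)$: fix a scaling parameter $s>1$. For each $k\ge1$ choose a maximal $s^{-k}$-separated set $Z_k\subseteq Z$; each point of $Z_k$ gives a vertex $v$ of level $\ell(v)=k$ with associated ball $B_v=B(v,2s^{-k})$ of radius $r(B_v)=2s^{-k}$ (the same letter $v$ denotes the vertex and the center of its ball). On level $0$ there is a single vertex $O$ associated to all of $Z$. Distinct vertices $v,w$ are joined by an edge iff $|\ell(v)-\ell(w)|\le1$ and $B_v\cap B_w\neq\emptyset$. $X$ carries the graph metric, each edge being isometric to $[0,1]$. A map $f:(X,d_X)\to(Y,d_Y)$ is a quasi-isometry if there are $C,D>0$ with $\frac1Cd_X(x,x')-D\le d_Y(f(x),f(x'))\le Cd_X(x,x')+D$ for all $x,x'\in X$, and every $y\in Y$ satisfies $d_Y(f(x),y)\le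 D$ for some $x\in X$. $\operatorname{Iso}(Y)$ is the isometry group of $Y$. The action of $G$ on $Y$ is cocompact if there is a compact $K\subseteq Y$ with $Y=\bigcup_{g\in G}gK$. A path in $X$ is a sequence of vertices $(v_k)$ with consecutive vertices joined by edges, together with the edges $e_k$ joining $v_k$ to $v_{k+1}$. A one-sided infinite path converges to $z\in Z$ if $v_k\to z$ (centers) and $r(B_{v_k})\to0$; a two-sided infinite path can have a limit as $k\to\infty$ and one as $k\to-\infty$. Weak norm: for a countable set $S$ and $f:S\to[0,\infty)$, $\|f\|_{p,\infty}$ is the infimum of $C>0$ such that $\#\{x\in S:f(x)>\lambda\}\le C^p/\lambda^p$ for all $\lambda>0$ (value $\infty$ if there is none). Weak capacity: nonempty open sets $A,B\subseteq Z$ are positively separated if $\operatorname{dist}(A,B)>0$. A function $\tau:E_X\to[0,\infty)$ is admissible for $A,B$ if $\sum_{e\in\gamma}\tau(e)\ge1$ for every two-sided infinite path $\gamma$ with one limit in $A$ and the other in $B$. Then $\mathrm{wcap}_p(A,B)=\inf\{\|\tau\|_{p,\infty}^p:\tau\text{ admissible for }A,B\}\in[0,\infty]$. Relative distance: $\Delta(A,B)=\operatorname{dist}(A,B)/\min(\operatorname{diam}A,\operatorname{diam}B)$. Control function: $\varphi_p(t)=\sup\{\mathrm{wcap}_p(A,B):A,B\subseteq Z\text{ open},\ \Delta(A,B)\ge t\}$ for $t>0$. Critical exponents: $Q_w(Z)=\inf\{p>1:\mathrm{wcap}_p(A,B)<\infty\text{ for all positively separated open }A,B\subseteq Z\}$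 and $Q_w'(Z)=\inf\{p>1:\text{there exists }t_0>0\text{ with }\varphi_p(t_0)<\infty\}$. ''Attained'' means that the infimum belongs to the set. *)

(* Defs.v *)
From HB Require Import structures.
From mathcomp Require Import all_boot all_order all_algebra.
From mathcomp Require Import all_classical all_reals all_analysis.
From mathcomp Require Import ring lra.

Set Implicit Arguments.
Unset Strict Implicit.
Unset Printing Implicit Defensive.

Import Order.TTheory GRing.Theory Num.Theory.
Import numFieldNormedType.Exports.

Local Open Scope classical_set_scope.
Local Open Scope ring_scope.

Section metric_notions.
Context {R : realType} {T : metricType R}.
Implicit Types A B : set T.

(* Real-valued: these are only meant for nonempty sets, and for bounded sets
   in the case of [diam]; every subset of a compact space is bounded.  In
   [reldist], nonempty open sets have positive diameter as soon as the space is
   connected and has at least two points. *)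
Definition diam A : R := sup [set mdist z.1 z.2 | z in A `*` A].

Definition setdist A B : R := inf [set mdist z.1 z.2 | z in A `*` B].

Definition reldist A B : R := setdist A B / Num.min (diam A) (diam B).

Definition r_separated (r : R) A :=
  forall x y, A x -> A y -> x != y -> r <= mdist x y.

Definition maximal_separated (r : R) A :=
  r_separated r A /\ forall B, A `<=` B -> r_separated r B -> B = A.

(* A measure on a metric space is here an outer measure on all subsets for
   which Borel sets are measurable. *)
Definition borel_regular (mu : {outer_measure set T -> \bar R}) :=
  (forall B, <<s @open T >> B -> mu.-caratheodory B) /\
  (forall A, exists B, [/\ <<s @open T >> B, A `<=` B & mu B = mu A]).

Definition ahlfors_Qregular (mu : {outer_measure set T -> \bar R}) (Q : R) :=
  exists c C : R, [/\ 0 < c, 0 < C &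
    forall (z : T) (r : R), 0 < r -> r <= diam setT ->
      ((c * r `^ Q)%:E <= mu (ball z r) <= (C * r `^ Q)%:E)%E].

Definition ahlfors_regular (mu : {outer_measure set T -> \bar R}) :=
  exists Q : R, ahlfors_Qregular mu Q.

End metric_notions.

Definition quasi_isometry {R : realType} {X Y : metricType R} (f : X -> Y) :=
  exists C D : R, [/\ 0 < C, 0 < D,
    forall x x', C^-1 * mdist x x' - D <= mdist (f x) (f x')
                 <= C * mdist x x' + D &
    forall y, exists x, mdist (f x) y <= D].

Definition quasi_isometric {R : realType} (X Y : metricType R) :=
  exists f : X -> Y, quasi_isometry f.

Section isometry_group.
Context {R : realType} (Y : metricType R).
Implicit Type G : set (Y -> Y).

Definition Iso : set (Y -> Y) :=
  [set g : Y -> Y | bijective g /\ forall x y, mdist (g x) (g y) = mdist x y].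

Definition isometry_subgroup G :=
  [/\ G `<=` Iso, G id,
      forall g h, G g -> G h -> G (g \o h) &
      forall g, G g -> exists h, [/\ G h, cancel g h & cancel h g]].

Definition cocompact_action G :=
  exists2 K : set Y, compact K & [set: Y] = \bigcup_(g in G) (g @` K).

End isometry_group.

Record graph := Graph {
  gvertex :> choiceType;
  adj : gvertex -> gvertex -> Prop;
  adj_sym : forall v w, adj v w -> adj w v;
  adj_irr : forall v, ~ adj v v;
  adj_conn : forall v w, exists n (u : nat -> gvertex),
    [/\ u 0 = v, u n = w & forall i, (i < n)%N -> adj (u i) (u i.+1)]
}.

Section edges.
Variable G : graph.

Definition edge_set : set (set G) :=
  [set e | exists v w : G, adj v w /\ e = [set v; w]].

Definition edge := set_type edge_set.

End edges.

Section realization.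
Variables (R : realType) (G : graph).

(* Points are given by barycentric coordinates: [segment v w] is the closed edge
   from v to w, and the single vertex v if v = w. *)
Definition segment (v w : G) : set (G -> R) :=
  [set x | exists t : R, [/\ 0 <= t, t <= 1 &
     x = fun u => t * (u == v)%:R + (1 - t) * (u == w)%:R]].

Definition graph_point : set (G -> R) :=
  [set x | exists v w : G, (v = w \/ adj v w) /\ segment v w x].

Definition realization := set_type graph_point.

HB.instance Definition _ := Choice.on realization.

(* [chain x y l]: some piecewise linear path c from x to y has length l; its
   i-th piece lies on the edge from v i to w i, which is isometric to [0, 1]
   through the v i-coordinate. *)
Definition chain (x y : realization) (l : R) :=
  exists n (c : nat -> realization) (v w : nat -> G),
    [/\ c 0 = x, c n = y,
        forall i, (i < n)%N -> [/\ adj (v i) (w i),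
          segment (v i) (w i) (val (c i)) &
          segment (v i) (w i) (val (c i.+1))] &
        l = \sum_(i < n) `|val (c i) (v i) - val (c i.+1) (v i)|].

Definition gdist (x y : realization) : R := inf (chain x y).

Lemma chain_ge0 x y l : chain x y l -> 0 <= l.
Proof. by move=> [n [c [v [w [_ _ _ ->]]]]]; apply: sumr_ge0. Qed.

Lemma chain_refl x : chain x x 0.
Proof.
have [v _] := set_mem (valP x); exists 0%N, (fun=> x), (fun=> v), (fun=> v).
by split=> //; rewrite big_ord0.
Qed.

Lemma chain_sym x y l : chain x y l -> chain y x l.
Proof.
move=> [n [c [v [w [c0 cn h ->]]]]].
exists n, (fun i => c (n - i)%N), (fun i => v (n - i.+1)%N),
  (fun i => w (n - i.+1)%N); split => /=.
- by rewrite subn0.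
- by rewrite subnn.
- move=> i ltin; have /h[a b] : (n - i.+1 < n)%N.
    by rewrite -subSn // subSS leq_subr.
  by rewrite -subSn // subSS => d; split.
- rewrite (reindex_inj rev_ord_inj)/=; apply: eq_bigr => i _.
  by rewrite distrC -subSn // subSS.
Qed.

Lemma chain_cat x y z l m : chain x y l -> chain y z m -> chain x z (l + m).
Proof.
move=> [n [c [v [w [c0 cn h ->]]]]] [n' [c' [v' [w' [c0' cn' h' ->]]]]].
pose pick T (f f' : nat -> T) i := if (i < n)%N then f i else f' (i - n)%N.
have cE i : (i <= n)%N -> pick _ c c' i = c i.
  rewrite leq_eqVlt /pick => /predU1P[->|->//].
  by rewrite ltnn subnn c0' cn.
have cE' i : (n <= i)%N -> pick _ c c' i = c' (i - n)%N.
  by rewrite /pick leqNgt => /negbTE ->.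
exists (n + n')%N, (pick _ c c'), (pick _ v v'), (pick _ w w'); split.
- by rewrite cE.
- by rewrite cE' ?leq_addr // addKn.
- move=> i ltin; case: (ltnP i n) => [lt|le].
    by rewrite !cE ?(ltnW lt) // /pick lt; apply: h.
  rewrite !cE' ?(leqW le) // /pick ltnNge le /= subSn //.
  by apply: h'; rewrite ltn_subLR.
- rewrite big_split_ord /=; congr (_ + _); apply: eq_bigr => i _.
    by rewrite !cE ?(ltnW (ltn_ord i)) // /pick ltn_ord.
  rewrite !cE' ?leq_addr ?(leqW (leq_addr _ _)) // -addnS !addKn /pick.
  by rewrite ltnNge leq_addr /= addKn.
Qed.

Lemma segmentC v w : segment v w = segment w v.
Proof.
wlog suff: v w / segment v w `<=` segment w v.
  by move=> h; apply/seteqP; split; exact: h.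
move=> x [t [t0 t1 ->]]; exists (1 - t).
by split; [lra|lra|apply/funext => u; rewrite addrC subKr].
Qed.

Lemma segment_l v w : segment v w (fun u => (u == v)%:R).
Proof.
by exists 1; split=> //; apply/funext => u; rewrite mul1r subrr mul0r addr0.
Qed.

Lemma vpoint_subproof v : (fun u => (u == v)%:R) \in graph_point.
Proof. by apply/mem_set; exists v, v; split; [left|exact: segment_l]. Qed.

Definition vpoint (v : G) : realization := SigSub (vpoint_subproof v).

Lemma chain_vpoint v w : exists l, chain (vpoint v) (vpoint w) l.
Proof.
have [n [u [u0 un h]]] := adj_conn v w.
eexists; exists n, (vpoint \o u), u, (u \o S).
split; [by rewrite /= u0|by rewrite /= un| |reflexivity].
move=> i lti; split; [exact: h|exact: segment_l|].
by rewrite segmentC; exact: segment_l.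
Qed.

Lemma chain_to_vpoint x : exists v l, chain x (vpoint v) l.
Proof.
have [v [w [vw xvw]]] := set_mem (valP x); exists v.
case: vw => [vw|vw]; last first.
  eexists; exists 1, (fun i => if i is 0 then x else vpoint v), (fun=> v), (fun=> w).
  split=> //; move=> [|//] _; split=> //; exact: segment_l.
suff -> : x = vpoint v by exists 0; exact: chain_refl.
apply/val_inj => /=; case: xvw => t [_ _ ->].
by apply/funext => u; rewrite -vw -mulrDl addrC subrK mul1r.
Qed.

Lemma has_inf_chain x y : has_inf (chain x y).
Proof.
split; last by exists 0 => l /chain_ge0.
have [v [l xv]] := chain_to_vpoint x; have [w [m yw]] := chain_to_vpoint y.
have [k vw] := chain_vpoint v w.
exists (l + (k + m)); apply: chain_cat xv _.
by apply: chain_cat vw _; exact: chain_sym.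
Qed.

Lemma gdist_le x y l : chain x y l -> gdist x y <= l.
Proof. by move=> h; apply: ge_inf => //; case: (has_inf_chain x y). Qed.

Lemma gdistxx x : gdist x x = 0.
Proof.
apply/eqP; rewrite eq_le (gdist_le (chain_refl x)) /=.
by apply: lb_le_inf; [exists 0; exact: chain_refl|move=> l /chain_ge0].
Qed.

Lemma gdist_sym x y : gdist x y = gdist y x.
Proof. by congr inf; apply/seteqP; split => l /chain_sym. Qed.

Lemma gdist_triangle y x z : gdist x z <= gdist x y + gdist y z.
Proof.
apply/ler_addgt0Pr => e e0.
have e2 : 0 < e / 2 by rewrite divr_gt0.
have [l xy hl] := inf_adherent e2 (has_inf_chain x y).
have [m yz hm] := inf_adherent e2 (has_inf_chain y z).
apply: (le_trans (gdist_le (chain_cat xy yz))).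
move: hl hm; rewrite -/(gdist x y) -/(gdist y z) => hl hm; lra.
Qed.

Lemma segment_le v w x y u : adj v w -> segment v w x -> segment v w y ->
  `|x u - y u| <= `|x v - y v|.
Proof.
move=> vw [t [_ _ ->]] [t' [_ _ ->]].
have nvw : (v == w) = false.
  by apply/eqP => e; apply: (@adj_irr _ w); rewrite -{1}e.
rewrite eqxx nvw; case: (u =P v) => [->|_]; first by rewrite nvw.
case: (u =P w) => _; last by rewrite !mulr0 !addr0 subrr normr0.
rewrite le_eqVlt; apply/orP; left; rewrite -normrN; apply/eqP; congr `|_|.
by ring.
Qed.

Lemma coord_le_gdist x y u : `|val x u - val y u| <= gdist x y.
Proof.
apply: lb_le_inf; first by case: (has_inf_chain x y).
move=> _ [n [c [v [w [<- <- h ->]]]]].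
elim: n h => [|n IH] h; first by rewrite big_ord0 subrr normr0.
rewrite big_ord_recr /=.
apply: le_trans (ler_distD (val (c n) u) _ _) _; apply: lerD.
  by apply: IH => i lti; apply: h; exact: leqW.
by have [] := h n (ltnSn n) => a b d; exact: segment_le a b d.
Qed.

Lemma gdist_pos x y : gdist x y = 0 -> x = y.
Proof.
move=> d0; apply/val_inj/funext => u; apply/eqP.
by rewrite -subr_eq0 -normr_le0 -d0; exact: coord_le_gdist.
Qed.

(* So [gdist] is the graph metric: each edge is isometric to [0, 1]. *)
Lemma gdist_edge v w x y : adj v w ->
  segment v w (val x) -> segment v w (val y) ->
  gdist x y = `|val x v - val y v|.
Proof.
move=> vw xvw yvw; apply/eqP; rewrite eq_le coord_le_gdist andbT.
apply: gdist_le; exists 1%N, (fun i => if i is 0 then x else y), (fun=> v), (fun=> w).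
by split=> //; [case|rewrite big_ord1].
Qed.

HB.instance Definition _ :=
  @isMetric.Build R realization gdist gdistxx gdist_pos gdist_sym gdist_triangle.

End realization.

Definition weak_norm {R : realType} (S : choiceType) (p : R) (f : S -> R) : \bar R :=
  ereal_inf [set C%:E | C in [set C : R | 0 < C /\
    forall lam : R, 0 < lam ->
      (counting [set x : S | (lam < f x)%R] <= (C `^ p / lam `^ p)%:E)%E]].

Record hyperbolic_filling (R : realType) (Z : metricType R) := HyperbolicFilling {
  scaling : R;
  scaling_gt1 : 1 < scaling;
  net : nat -> set Z; (* [net 0] is not used *)
  net_max : forall k, (0 < k)%N -> maximal_separated (scaling ^- k) (net k)
}.

Section filling.
Context {R : realType} {Z : metricType R}.
Variable X : hyperbolic_filling Z.
Local Notation s := (scaling X).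

(* The vertex O is [None]. *)
Definition vertex :=
  option [set kz : nat * Z | (0 < kz.1)%N /\ net X kz.1 kz.2].

HB.instance Definition _ := Choice.on vertex.

Definition vlevel (v : vertex) : nat :=
  if v is Some a then (val a).1 else 0.

Definition vcenter (v : vertex) : option Z :=
  if v is Some a then Some (val a).2 else None.

(* The radius of B_O is immaterial, as long as it is positive. *)
Definition vradius (v : vertex) : R := 2 * s ^- vlevel v.

Definition vball (v : vertex) : set Z :=
  if vcenter v is Some z then ball z (vradius v) else setT.

Definition filling_adj (v w : vertex) :=
  [/\ v != w, `|(vlevel v)%:Z - (vlevel w)%:Z| <= 1
    & vball v `&` vball w !=set0].

Lemma filling_adj_sym v w : filling_adj v w -> filling_adj w v.
Proof. by move=> [a b c]; split; rewrite 1?eq_sym 1?distrC 1?setIC. Qed.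

Lemma filling_adj_irr v : ~ filling_adj v v.
Proof. by case; rewrite eqxx. Qed.

Lemma net_dense k (z : Z) : (0 < k)%N ->
  exists2 x, net X k x & mdist x z < s ^- k.
Proof.
move=> k0; have [sep mx] := net_max X k0; apply: contrapT => far.
have {}far x : net X k x -> s ^- k <= mdist x z.
  by move=> kx; rewrite leNgt; apply/negP => lt; apply: far; exists x.
have sk : 0 < s ^- k.
  by rewrite invr_gt0 exprn_gt0 // (lt_trans _ (scaling_gt1 X)).
have kz : net X k z.
  rewrite -(mx (net X k `|` [set z])); [by right|by left|].
  move=> x y [kx|->] [ky|->] xy; first exact: sep.
  - exact: far.
  - by rewrite metric_sym; exact: far.
  - by rewrite eqxx in xy.
by have := far z kz; rewrite mdistxx leNgt sk.
Qed.

Lemma filling_adj_conn v w : exists n (u : nat -> vertex),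
  [/\ u 0 = v, u n = w & forall i, (i < n)%N -> filling_adj (u i) (u i.+1)].
Proof.
pose linked v w := exists n (u : nat -> vertex),
  [/\ u 0 = v, u n = w & forall i, (i < n)%N -> filling_adj (u i) (u i.+1)].
have sym a b : linked a b -> linked b a.
  move=> [n [u [u0 un h]]]; exists n, (fun i => u (n - i)%N).
  split; rewrite ?subn0 ?subnn // => i lti; apply: filling_adj_sym.
  by rewrite -(subnSK lti); apply: h; rewrite -subSn // subSS leq_subr.
have step a b c : filling_adj a b -> linked b c -> linked a c.
  move=> ab [n [u [u0 un h]]].
  exists n.+1, (fun i => if i is j.+1 then u j else a).
  by split=> // -[_|i /h //]; rewrite u0.
have cat a b c : linked a b -> linked b c -> linked a c.
  move=> [n [u [<- <- h]]]; elim: n u h => [//|n IH] u h uc.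
  apply: (step _ (u 1%N)); first exact: h.
  by apply: (IH (u \o S)) => // i; exact: (h i.+1).
suff toO k a : vlevel a = k -> linked a None.
  by apply: (cat _ None); [exact: toO|apply/sym; exact: toO].
elim: k a => [|k IH] [[[j z] jz]|] //= ak.
- by move: jz; rewrite ak => jz; have [] := set_mem jz.
- by exists 0%N, (fun=> None); split.
move: jz; rewrite ak => jz; have [_ /= kz] := set_mem jz.
pose b := Some (SigSub jz) : vertex.
have s0 : 0 < s by apply: lt_trans (scaling_gt1 X).
have zb : vball b z.
  by apply: ballxx; rewrite mulr_gt0 // invr_gt0 exprn_gt0.
case: k => [|k] in IH ak jz kz b zb *.
  by apply: (step _ None); [split=> //; exists z|exists 0%N, (fun=> None); split].
have [x kx xz] := @net_dense k.+1 z isT.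
have kx' : (k.+1, x) \in [set kz : nat * Z | (0 < kz.1)%N /\ net X kz.1 kz.2].
  by apply/mem_set.
apply: (step _ (Some (SigSub kx'))); last by apply: IH.
split; first by apply/eqP => -[/esym/eqP]; rewrite ltn_eqF.
- by rewrite /= -addn1 PoszD addrAC subrr add0r normr1.
- exists z; split=> //; rewrite /vball /= ballEmdist /= (lt_trans xz) //.
  by rewrite /vradius /= ltr_pMl ?invr_gt0 ?exprn_gt0 // ltr1n.
Qed.

Definition filling_graph : graph :=
  Graph filling_adj_sym filling_adj_irr filling_adj_conn.

Definition joins (v : int -> filling_graph) (e : int -> edge filling_graph) :=
  forall k, val (e k) = [set v k; v (k + 1)] /\ adj (v k) (v (k + 1)).

Definition path_cvg (v : nat -> filling_graph) (z : Z) :=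
  (forall eps : R, 0 < eps -> \forall k \near \oo,
     exists2 c, vcenter (v k) = Some c & mdist c z < eps) /\
  vradius (v k) @[k --> \oo] --> (0 : R).

Definition connecting (v : int -> filling_graph) (A B : set Z) :=
  exists a b, [/\ path_cvg (fun k => v (- k%:Z)) a,
                  path_cvg (fun k => v k%:Z) b &
                  (A a /\ B b) \/ (B a /\ A b)].

Definition admissible (A B : set Z) (tau : edge filling_graph -> R) :=
  (forall e, 0 <= tau e) /\
  forall v e, joins v e -> connecting v A B ->
    (1 <= \esum_(k in [set: int]) (tau (e k))%:E)%E.

Definition wcap (p : R) (A B : set Z) : \bar R :=
  ereal_inf [set poweR (weak_norm p tau) p | tau in admissible A B].

Definition positively_separated (A B : set Z) :=
  [/\ open A, open B, A !=set0, B !=set0 & 0 < setdist A B].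

Definition control (p t : R) : \bar R :=
  ereal_sup [set wcap p AB.1 AB.2 | AB in [set AB : set Z * set Z |
    [/\ open AB.1, open AB.2, AB.1 !=set0, AB.2 !=set0
      & t <= reldist AB.1 AB.2]]].

Definition Qw_set : set R := [set p | 1 < p /\
  forall A B, positively_separated A B -> (wcap p A B < +oo)%E].

Definition Qw'_set : set R := [set p | 1 < p /\
  exists2 t0 : R, 0 < t0 & (control p t0 < +oo)%E].

End filling.

Definition crit_inf {R : realType} (P : set R) : \bar R :=
  ereal_inf [set p%:E | p in P].

Definition attained {R : realType} (P : set R) :=
  exists2 p, P p & p%:E = crit_inf P.

Section critical_exponents.
Context {R : realType} {Z : metricType R}.
Variable X : hyperbolic_filling Z.

Definition Qw : \bar R := crit_inf (Qw_set X).
Definition Qw' : \bar R := crit_inf (Qw'_set X).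

End critical_exponents.

(* Main.v *)
(* Let [p] be such that all positively separated open sets have finite
   [wcap p].  For [eta > 0], cover Z by finitely many small balls and take the
   maximum of functions admissible for the pairs of balls at a positive distance:
   a single function tau gives mass at least 1 to every path whose limits are
   [eta]-apart.  Now let A, B be open with relative distance at least 1, A being
   the one of smaller diameter, and let o be a vertex at the location and scale
   of A.  A conjugate F of an isometry of Y is a quasi-isometry of the filling
   moving o close to the root, with constants independent of A and B.  The
   Gromov product at o of points near A and B is bounded (it is the logarithm of
   a cross-ratio), and quasi-isometries of a hyperbolic graph coarsely preserve
   Gromov products, so F maps paths from A to B close to paths whose limits are
   [eta]-apart for a uniform [eta].  Pulling tau back along F bounds
   [wcap p A B] by a uniform constant; bounded degree, hence Ahlfors regularity,
   enters here.  The other inclusion only needs a cover by small balls, so that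
   both sets of exponents coincide. *)

Require Import Defs.
From HB Require Import structures.
From mathcomp Require Import all_boot all_order all_algebra finmap.
From mathcomp Require Import all_classical all_reals all_analysis.
From mathcomp Require Import zify ring lra.

Set Implicit Arguments.
Unset Strict Implicit.
Unset Printing Implicit Defensive.

Import Order.TTheory GRing.Theory Num.Theory.
Import numFieldNormedType.Exports.

Local Open Scope classical_set_scope.
Local Open Scope ring_scope.

(** * Gromov products in hyperbolic graphs *)

Section graph_distance.
Variable G : graph.
Implicit Types u v w : G.
Local Open Scope nat_scope.

Definition walk n v w := exists u : nat -> G,
  [/\ u 0 = v, u n = w & forall i, i < n -> adj (u i) (u i.+1)].

Lemma walk_rev n v w : walk n v w -> walk n w v.
Proof.
move=> [u [u0 un h]]; exists (fun i => u (n - i)); split.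
- by rewrite subn0.
- by rewrite subnn.
move=> i ltin; apply: adj_sym; rewrite -(subnSK ltin); apply: h; lia.
Qed.

Lemma walk_cat m n u v w : walk m u v -> walk n v w -> walk (m + n) u w.
Proof.
move=> [a [a0 am ha]] [b [b0 bn hb]].
exists (fun i => if i < m then a i else b (i - m)); split.
- case: ifP => // /negbT; rewrite -leqNgt leqn0 => /eqP m0.
  by rewrite m0 subnn b0 -am m0.
- by rewrite ltnNge leq_addr /= addKn.
move=> i lti; case: (ltnP i m) => im.
  case: (ltnP i.+1 m) => im'; first exact: ha.
  have e : i.+1 = m by lia.
  by rewrite e subnn b0 -am -e; apply: ha.
have -> : (i.+1 < m) = false by lia.
by rewrite subSn //; apply: hb; lia.
Qed.

Fact has_walk v w : exists n, `[< walk n v w >].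
Proof. by have [n h] := adj_conn v w; exists n; apply/asboolP. Qed.

(** Natural-valued, so that four-point inequalities become linear integer arithmetic; [gdist_vpoint]
    compares it with the metric of the realization. *)
Definition gd v w := ex_minn (has_walk v w).

Lemma walk_gd v w : walk (gd v w) v w.
Proof. by rewrite /gd; case: ex_minnP => n /asboolP. Qed.

Lemma gd_le n v w : walk n v w -> gd v w <= n.
Proof. by move=> h; rewrite /gd; case: ex_minnP => m _; apply; apply/asboolP. Qed.

Lemma gdxx v : gd v v = 0.
Proof. by apply/eqP; rewrite -leqn0; apply: gd_le; exists (fun=> v); split. Qed.

Lemma gdC v w : gd v w = gd w v.
Proof.
by apply/eqP; rewrite eqn_leq !gd_le //; apply: walk_rev; exact: walk_gd.
Qed.

Lemma gd_tri v u w : gd u w <= gd u v + gd v w.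
Proof. by apply: gd_le; apply: walk_cat; exact: walk_gd. Qed.

Lemma gd_adj v w : adj v w -> gd v w <= 1.
Proof.
move=> vw; apply: gd_le; exists (fun i => if i is 0 then v else w); split=> //.
by case.
Qed.

Lemma gd_walk (u : nat -> G) n : (forall i, i < n -> adj (u i) (u i.+1)) ->
  forall i j, i <= j <= n -> gd (u i) (u j) <= j - i.
Proof.
move=> h i j /andP[ij jn]; apply: gd_le; exists (fun k => u (i + k)); split.
- by rewrite addn0.
- by rewrite subnKC.
by move=> k kji; rewrite addnS; apply: h; lia.
Qed.

(** A shortest walk works: by the triangle inequality, a shortcut between two of its vertices would
    shorten the whole walk. *)
Lemma geodesic v w : exists u : nat -> G,
  [/\ u 0 = v, u (gd v w) = w,
      forall i, i < gd v w -> adj (u i) (u i.+1) &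
      forall i j, i <= j <= gd v w -> gd (u i) (u j) = j - i].
Proof.
have [u [u0 un h]] := walk_gd v w; exists u; split=> // i j ij.
have a := gd_walk h ij.
have b : gd v (u i) <= i.
  by have := @gd_walk u _ h 0 i ltac:(lia); rewrite u0 subn0.
have c : gd (u j) w <= gd v w - j.
  by have := @gd_walk u _ h j (gd v w) ltac:(lia); rewrite un.
have := gd_tri (u i) v w; have := gd_tri (u j) (u i) w; lia.
Qed.

(** Gromov's four-point condition. *)
Definition hyperbolic (delta : nat) := forall x y z t : G,
  gd x y + gd z t <= maxn (gd x z + gd y t) (gd x t + gd y z) + delta.

(* Twice the Gromov product of [a] and [b] based at [p]. *)
Definition dprod p a b := gd p a + gd p b - gd a b.

(** The four-point condition for [a], [c], [p], [b], with both sides subtracted from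
    [gd p a + gd p b + gd p c]. *)
Lemma dprod_min delta : hyperbolic delta -> forall p a b c,
  minn (dprod p a b) (dprod p b c) <= dprod p a c + delta.
Proof.
move=> h p a b c; have := h a c p b; rewrite /dprod.
have := gd_tri p a b; have := gd_tri p b c; have := gd_tri p a c.
rewrite (gdC a p) (gdC b p) (gdC b c) (gdC c p); lia.
Qed.

Lemma dprod_lip o x y o' x' y' :
  dprod o' x' y' <= dprod o x y + 2 * (gd o o' + gd x x' + gd y y').
Proof.
have ox : gd o' x' <= gd o o' + gd o x + gd x x'.
  by have := gd_tri o o' x'; have := gd_tri x o x'; rewrite (gdC o' o); lia.
have oy : gd o' y' <= gd o o' + gd o y + gd y y'.
  by have := gd_tri o o' y'; have := gd_tri y o y'; rewrite (gdC o' o); lia.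
have xy : gd x y <= gd x x' + gd x' y' + gd y y'.
  by have := gd_tri x' x y; have := gd_tri y' x' y; rewrite (gdC y' y); lia.
rewrite /dprod; lia.
Qed.

(** The distances to [o] cancel in the four-point inequality, which becomes one between sums of two
    products at [o]. Each product on the larger side is controlled by two instances of the
    hypothesis, whence the doubled constant. *)
Lemma hyp_base delta o :
  (forall a b c, minn (dprod o a b) (dprod o b c) <= dprod o a c + delta) ->
  hyperbolic (2 * delta).
Proof.
move=> h x y z t.
have key a b c d P Q : minn a d <= P + delta -> minn c b <= P + delta ->
  minn a c <= Q + delta -> minn d b <= Q + delta ->
  minn (a + b) (c + d) <= P + Q + 2 * delta by lia.
have E a b : dprod o a b + gd a b = gd o a + gd o b.
  by rewrite /dprod subnK //; have := gd_tri o a b; rewrite (gdC a o).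
have C a b : dprod o a b = dprod o b a by rewrite /dprod (gdC a b) addnC.
have h1 := h x z y; have h2 := h x t y; have h3 := h z x t; have h4 := h z y t.
rewrite (C z x) in h3; rewrite (C t y) in h2; rewrite (C z y) in h1 h4.
have := key _ _ _ _ _ _ h1 h2 h3 h4.
have := E x y; have := E z t; have := E x z; have := E y t; have := E x t.
have := E y z.
move: (dprod o x y) (dprod o z t) (dprod o x z) (dprod o y t) (dprod o x t).
by move: (dprod o y z); lia.
Qed.

(* Halving the chain [k] times: the Gromov product only loses a logarithm of the
   length. *)
Lemma dprod_chain delta : hyperbolic delta -> forall p m k N (c : nat -> G),
  0 < N <= 2 ^ k -> (forall i, i < N -> m <= dprod p (c i) (c i.+1)) ->
  m <= dprod p (c 0) (c N) + k * delta.
Proof.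
move=> h p m; elim=> [|k IH] N c.
  case: N => [//|[|//]] _ /(_ 0 isT); rewrite mul0n addn0; exact.
move=> N2 hc; case: (ltnP 1 N) => N1; last first.
  have -> : N = 1 by lia.
  by apply: leq_trans (hc 0 _) (leq_addr _ _); lia.
have N2' : N <= 2 * 2 ^ k by rewrite -expnS; lia.
have := IH N./2 c ltac:(lia) (fun i iN => hc i ltac:(lia)).
have := IH (N - N./2) (fun i => c (N./2 + i)) ltac:(lia).
rewrite addn0 subnKC; last lia.
have hc' i : i < N - N./2 -> m <= dprod p (c (N./2 + i)) (c (N./2 + i.+1)).
  by move=> iN; rewrite addnS; apply: hc; lia.
move=> /(_ hc'); have := dprod_min h p (c 0) (c N./2) (c N); lia.
Qed.

(** Exponentials beat linear functions. For [k = D %/ delta.+1] and large [D], [k * k <= 2 ^ k]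
    makes the premise true, while [k * delta <= D] turns the conclusion into [D <= C]. *)
Lemma log_bound A B C delta : exists M, forall D,
  (forall k, A * D + B <= 2 ^ k -> 2 * D <= C + k * delta) -> D <= M.
Proof.
exists (C + delta.+1 * (2 * A * delta.+1 + B + 4)) => D h.
rewrite leqNgt; apply/negP => ltD.
pose k := D %/ delta.+1.
have kD : k * delta.+1 <= D by exact: leq_divM.
have Dk : D < k.+1 * delta.+1 by rewrite ltn_ceil.
have k1 : 2 * A * delta.+1 + B + 4 <= k.
  by rewrite leq_divRL // mulnC; lia.
have sq n : 4 <= n -> n * n <= 2 ^ n.
  elim: n => [//|n IH]; rewrite leq_eqVlt => /orP[/eqP <-//|n4].
  by rewrite expnS; have := IH ltac:(lia); nia.
have /h : A * D + B <= 2 ^ k.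
  apply: leq_trans (sq k _); last lia.
  apply: leq_trans (_ : (2 * A * delta.+1 + B) * k <= _); last by rewrite leq_mul2r; lia.
  have : A * D <= A * (k.+1 * delta.+1) by rewrite leq_mul2l ltnW ?orbT.
  nia.
rewrite mulnS in kD; lia.
Qed.

Definition qie (L : nat) (F : G -> G) := forall x y,
  gd (F x) (F y) <= L * gd x y + L /\ gd x y <= L * gd (F x) (F y) + L.

(* One half of the Morse lemma: a geodesic stays close to a quasi-geodesic with
   the same endpoints.  A point of the geodesic at maximal distance from the
   quasi-geodesic is bypassed by a path of length linear in that distance. *)
Lemma morse delta L : hyperbolic delta -> exists M, forall F, qie L F ->
  forall (n : nat) (u : nat -> G),
  (forall i j, i <= j <= n -> gd (u i) (u j) = j - i) ->
  forall (m : nat) (b : nat -> G), b 0 = F (u 0) -> b m = F (u n) ->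
  (forall i j, i <= j <= m -> gd (b i) (b j) = j - i) ->
  forall j, j <= m -> exists2 i, i <= n & gd (b j) (F (u i)) <= M.
Proof.
move=> h; have [M hM] := log_bound (6 * L) (L + 2) (2 * L) delta.
exists M => F qF n u hu m b b0 bm hb.
pose P D := forall j, j <= m -> exists2 i, i <= n & gd (b j) (F (u i)) <= D.
have exP : exists D, `[< P D >].
  exists m; apply/asboolP => j jm; exists 0 => //.
  by rewrite -b0 gdC hb ?subn0.
case: (ex_minnP exP) => D /asboolP PD Dmin.
suff : D <= M by move=> DM j /PD[i iN le]; exists i => //; exact: leq_trans DM.
have [->//|D0] := posnP D; apply: hM => k kD.
have [J Jm HJ] : exists2 J, J <= m & forall i, i <= n -> D <= gd (b J) (F (u i)).
  apply: contrapT => nJ; have /Dmin : `[< P D.-1 >]; last lia.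
  apply/asboolP => j jm; apply: contrapT => nj; apply: nJ; exists j => // i iN.
  rewrite leqNgt; apply/negP => lt; apply: nj; exists i => //; lia.
have hbJ i : i <= m -> gd (b J) (b i) = maxn (J - i) (i - J).
  move=> im; case: (leqP J i) => Ji; first by rewrite hb; lia.
  by rewrite gdC hb; lia.
set x := b J in HJ hbJ *.
(* The bypass leaves the geodesic [2 * D] before [x] and returns [2 * D] after it. Near an end,
   truncation selects the endpoint, which is itself an image under [F]. *)
have [iy [iyn dy py]] : exists iy, [/\ iy <= n,
    gd (b (J - 2 * D)) (F (u iy)) <= D &
    2 * D <= dprod x (b (J - 2 * D)) (F (u iy))].
  case: (leqP J (2 * D)) => JD.
    exists 0; have -> : J - 2 * D = 0 by lia.
    by rewrite /dprod b0 gdxx; split=> //; have := HJ 0 isT; lia.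
  have [i iN le] := PD (J - 2 * D) ltac:(lia); exists i; split=> //.
  have := HJ i iN; rewrite /dprod hbJ; lia.
have [iz [izn dz pz]] : exists iz, [/\ iz <= n,
    gd (b (minn m (J + 2 * D))) (F (u iz)) <= D &
    2 * D <= dprod x (b (minn m (J + 2 * D))) (F (u iz))].
  case: (leqP m (J + 2 * D)) => JD.
    exists n; rewrite bm /dprod gdxx; split=> //.
    by have := HJ n (leqnn n); lia.
  have [i iN le] := PD (J + 2 * D) ltac:(lia); exists i; split=> //.
  have := HJ i iN; rewrite /dprod hbJ; lia.
set y := b (J - 2 * D) in dy py *; set z := b (minn m (J + 2 * D)) in dz pz *.
have yz : gd y z <= 4 * D by rewrite hb; lia.
have pyz : dprod x y z = 0 by rewrite /dprod !hbJ ?hb; lia.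
have diz : maxn (iy - iz) (iz - iy) <= 6 * L * D + L.
  have [_] := qF (u iy) (u iz).
  have : gd (F (u iy)) (F (u iz)) <= 6 * D.
    have := gd_tri y (F (u iy)) (F (u iz)); have := gd_tri z y (F (u iz)).
    rewrite (gdC (F (u iy)) y); lia.
  have -> : gd (u iy) (u iz) = maxn (iy - iz) (iz - iy).
    by case: (leqP iy iz) => ?; [|rewrite gdC]; rewrite hu; lia.
  by move=> a b'; apply: leq_trans b' _; rewrite leq_add2r [6 * _]mulnC -mulnA leq_mul2l a orbT.
(* From [y] to a nearby image, along the images of consecutive [u i] (in either direction), then to
   [z]. The images are at distance at least [D] from [x], whereas the product of [y] and [z] at [x]
   is zero. *)
pose c t := if t is t'.+1 then
   (if t' <= maxn (iy - iz) (iz - iy) then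
    F (u (if iy <= iz then iy + t' else iy - t')) else z) else y.
pose N := (maxn (iy - iz) (iz - iy)).+2.
have := @dprod_chain delta h x (2 * D - 2 * L) k N c ltac:(lia).
rewrite /= ltnn pyz => H; suff : 2 * D - 2 * L <= 0 + k * delta by lia.
apply: H => -[_|t tN] /=.
  have -> : (if iy <= iz then iy + 0 else iy - 0) = iy by case: ifP; lia.
  lia.
have t1 : t <= maxn (iy - iz) (iz - iy) by lia.
rewrite t1; case: (leqP t.+1 (maxn (iy - iz) (iz - iy))) => t2; last first.
  have -> : (if iy <= iz then iy + t else iy - t) = iz by case: ifP; lia.
  by move: pz; rewrite /dprod (gdC z); lia.
have step i : i < n ->
    2 * D - 2 * L <= gd x (F (u i)) + gd x (F (u i.+1)) - gd (F (u i)) (F (u i.+1)).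
  move=> iN; have [] := qF (u i) (u i.+1); rewrite hu; last lia.
  have := HJ i ltac:(lia); have := HJ i.+1 ltac:(lia); lia.
rewrite /dprod; case: ifP => iyz.
  by rewrite addnS; apply: step; lia.
have e : iy - t = (iy - t.+1).+1 by lia.
rewrite e (gdC (F (u _.+1))) [gd x (F (u _.+1)) + _]addnC; apply: step; lia.
Qed.

(** The Gromov product at [o] is, up to a constant, the distance from [o] to a geodesic, and by
    [morse] a geodesic between the images passes near images of the original one. *)
Lemma dprod_qie delta L : hyperbolic delta -> exists K, forall F, qie L F ->
  forall o v w, dprod o v w <= K * dprod (F o) (F v) (F w) + K.
Proof.
move=> h; have [M hM] := morse L h.
exists (L + 2 * L * (delta + 1 + M) + 2 * L) => F qF o v w.
have [u [u0 un _ hu]] := geodesic v w.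
have [b [b0 bm _ hb]] := geodesic (F v) (F w).
set p := F o; set m := gd (F v) (F w) in bm hb *.
(* The Gromov product of [p] and [F w] at [F v]: [b j] is the point where the inscribed circle of
   the triangle would touch this side, and the four-point condition bounds its distance to [p]. *)
pose j := (gd (F v) p + m - gd p (F w))./2.
have t1 := gd_tri p (F v) (F w); have t2 := gd_tri (F v) p (F w).
have t3 := gd_tri (F w) (F v) p; rewrite (gdC (F w) p) in t3.
have jm : j <= m by rewrite /j /m; lia.
have px : 2 * gd p (b j) <= dprod p (F v) (F w) + 2 * delta + 2.
  have := h p (b j) (F v) (F w); rewrite /dprod -/m.
  have := @hb 0 j ltac:(lia); have := @hb j m ltac:(lia); rewrite b0 bm.
  rewrite (gdC (b j) (F v)) (gdC p (F v)) => -> ->.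
  by move: t1 t2 t3; rewrite -/m; rewrite (gdC p (F v)) /j; lia.
have [i iN le] := hM F qF _ u hu m b (etrans b0 (congr1 F (esym u0)))
  (etrans bm (congr1 F (esym un))) hb j jm.
have [_ qo] := qF o (u i).
have le1 : dprod o v w <= 2 * gd o (u i).
  have := gd_tri (u i) o v; have := gd_tri (u i) o w.
  have := @hu 0 i ltac:(lia); have := @hu i (gd v w) ltac:(lia); rewrite u0 un.
  rewrite /dprod (gdC (u i) v); lia.
have := gd_tri (b j) p (F (u i)).
set g := gd p (F (u i)) in qo *; set P := dprod p _ _ in px *.
move=> gle; have : 2 * (L * g) <= L * (P + 2 * delta + 2 + 2 * M).
  by rewrite mulnCA leq_mul2l; apply/orP; right; lia.
have : 0 <= 2 * L * (delta + 1 + M) * P by [].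
have : 0 <= 2 * L * P by [].
lia.
Qed.

End graph_distance.

(** * Distances in the realization *)

Section realization_distance.
Variables (R : realType) (G : graph).
Implicit Types (u v w : G) (x y : realization R G).

(* The affine extension of [gd u] to the edges; it is 1-Lipschitz. *)
Let height u x : R := \sum_(a \in [set: G]) val x a * (gd u a)%:R.

Let height_segment u v w t x : v != w ->
  val x = (fun a => t * (a == v)%:R + (1 - t) * (a == w)%:R) ->
  height u x = t * (gd u v)%:R + (1 - t) * (gd u w)%:R.
Proof.
move=> vw xE; rewrite /height (fsbigE [:: v; w]) /=.
- rewrite !big_cons big_nil xE !eqxx (eq_sym w v) (negPf vw) mem_set // mem_set //=.
  by rewrite !mulr0 !mulr1 !addr0 add0r.
- by rewrite inE vw.
- by [].
- move=> a _; rewrite !inE negb_or => /andP[/negPf av /negPf aw].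
  by rewrite xE av aw !mulr0 addr0 mul0r.
Qed.

Let height_lip u v w x y : adj v w ->
  segment v w (val x) -> segment v w (val y) ->
  `|height u x - height u y| <= `|val x v - val y v|.
Proof.
move=> vw [t [t0 t1 xE]] [t' [t'0 t'1 yE]].
have nvw : v != w by apply/eqP => e; apply: (@adj_irr _ w); rewrite -{1}e.
rewrite (height_segment u nvw xE) (height_segment u nvw yE) xE yE.
rewrite eqxx (negPf nvw) !mulr0 !mulr1 !addr0.
have -> : t * (gd u v)%:R + (1 - t) * (gd u w)%:R -
   (t' * (gd u v)%:R + (1 - t') * (gd u w)%:R) =
   (t - t') * ((gd u v)%:R - (gd u w)%:R) :> R by ring.
rewrite normrM ler_piMr //.
have := gd_tri v u w; have := gd_tri w u v.
rewrite (gdC w v) => a b; have c := gd_adj vw.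
have: ((gd u v)%:R <= (gd u w)%:R + 1 :> R) by rewrite natr1 ler_nat; lia.
have: ((gd u w)%:R <= (gd u v)%:R + 1 :> R) by rewrite natr1 ler_nat; lia.
rewrite ler_norml; lra.
Qed.

Let height_vpoint u w : height u (vpoint R w) = (gd u w)%:R.
Proof.
rewrite /height (fsbigE [:: w]) //=.
- by rewrite big_cons big_nil mem_set //= eqxx mul1r addr0.
- by move=> a _; rewrite inE => /negPf ->; rewrite mul0r.
Qed.

(** A shortest walk is a chain of that length; conversely [height v] increases along any chain by at
    most its length. *)
Lemma gdist_vpoint v w : mdist (vpoint R v) (vpoint R w) = (gd v w)%:R.
Proof.
apply/eqP; rewrite eq_le; apply/andP; split.
  have [u [u0 un h]] := walk_gd v w; apply: gdist_le.
  exists (gd v w), (fun i => vpoint R (u i)), u, (fun i => u i.+1).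
  split=> [||i lti|]; [by rewrite u0|by rewrite un| |].
    split; [exact: h|exact: segment_l|].
    by rewrite segmentC; exact: segment_l.
  rewrite (eq_bigr (fun=> 1)) => [|i _]; last first.
    rewrite /= eqxx; have -> : (u i == u i.+1) = false; last by rewrite subr0 normr1.
    by apply/eqP => e; apply: (@adj_irr _ (u i)); rewrite {2}e; apply: h.
  by rewrite sumr_const card_ord.
rewrite -height_vpoint.
apply: lb_le_inf; first by case: (has_inf_chain (vpoint R v) (vpoint R w)).
move=> l [n [c [a [b [c0 cn h ->]]]]].
suff H : height v (c n) - height v (c 0%N) <= \sum_(i < n) `|val (c i) (a i) - val (c i.+1) (a i)|.
  apply: le_trans H; rewrite c0 cn !height_vpoint gdxx subr0 //.
elim: n {cn} h => [|n IH] h; first by rewrite big_ord0 subrr.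
rewrite big_ord_recr /=; have /IH le1 : forall i, (i < n)%N -> [/\ adj (a i) (b i),
     segment (a i) (b i) (val (c i)) & segment (a i) (b i) (val (c i.+1))].
  by move=> i lti; apply: h; exact: leqW.
have [] := h n (ltnSn n) => ab s1 s2.
have := height_lip v ab s1 s2; rewrite ler_norml => /andP[le2 _]; lra.
Qed.

Lemma gdist_near_vpoint x : exists v, mdist x (vpoint R v) <= 1.
Proof.
have [v [w [vw xvw]]] := set_mem (valP x); exists v.
case: vw => [vw|vw].
  have -> : x = vpoint R v; last by rewrite mdistxx.
  apply/val_inj => /=; case: xvw => t [_ _ ->].
  by apply/funext => u; rewrite -vw -mulrDl addrC subrK mul1r.
have vvw : segment v w (val (vpoint R v)) by exact: segment_l.
rewrite [mdist _ _](gdist_edge vw xvw vvw).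
case: xvw => t [t0 t1 ->]; rewrite /= eqxx.
have -> : (v == w) = false.
  by apply/eqP => e; apply: (@adj_irr _ w); rewrite -{1}e.
rewrite mulr0 mulr1 addr0 -[true%:R]/(1 : R) ler_norml; lra.
Qed.

End realization_distance.

(** * Hyperbolicity of the filling *)

Lemma exprn_unbounded (R : realType) (x y : R) : 1 < x -> exists n, y <= x ^+ n.
Proof.
move=> x1; have x10 : 0 < x - 1 by rewrite subr_gt0.
have bern n : 1 + n%:R * (x - 1) <= x ^+ n.
  elim: n => [|n IH]; first by rewrite mul0r addr0 expr0.
  rewrite exprS -natr1; have := ler_wpM2l (ltW (lt_trans ltr01 x1)) IH.
  by have : 0 <= n%:R * (x - 1) by [rewrite mulr_ge0 // ltW]; nra.
exists (Num.bound `|y / (x - 1)|); apply: le_trans (bern _).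
have := le_lt_trans (ler_norm _) (archi_boundP (normr_ge0 (y / (x - 1)))).
rewrite ltr_pdivrMr //; lra.
Qed.

Section filling_geometry.
Variables (R : realType) (Z : metricType R) (X : hyperbolic_filling Z) (z0 : Z).
Hypothesis Z_le1 : forall x y : Z, mdist x y <= 1.
Local Notation s := (scaling X).
Local Notation V := (filling_graph X).
Implicit Types u v w : V.
Local Notation lev := (@vlevel R Z X).
Local Notation root := (None : V).

Let s1 : 1 < s := scaling_gt1 X.
Let s0 : 0 < s. Proof. exact: lt_trans s1. Qed.

(** As [dprod] is twice the Gromov product, a power of this root with exponent [dprod] is [s] to the
    Gromov product. *)
Definition sqrt_scaling : R := Num.sqrt s.
Local Notation q := sqrt_scaling.

Lemma q_sqr : q ^+ 2 = s. Proof. by rewrite sqr_sqrtr // ltW. Qed.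

Lemma q_gt1 : 1 < q.
Proof. by rewrite -(@ltr_pXn2r _ 2) ?nnegrE ?sqrtr_ge0 // q_sqr expr1n. Qed.

Let q0 : 0 < q. Proof. exact: lt_trans q_gt1. Qed.

(* [z0] plays the role of the center of the vertex O. *)
Definition cen v : Z := odflt z0 (vcenter v).

(* Comparable to [s] to the power minus the Gromov product at the root. *)
Definition rho v w := mdist (cen v) (cen w) + s ^- lev v + s ^- lev w.

Lemma powN_gt0 n : 0 < s ^- n. Proof. by rewrite invr_gt0 exprn_gt0. Qed.
Hint Resolve powN_gt0 : core.

(** The root fits as well: its formal radius is 2, more than any distance in [Z]. *)
Lemma vballE v x : vball v x <-> mdist (cen v) x < 2 * s ^- lev v.
Proof.
case: v => [a|] /=; rewrite /vball /= ?ballEmdist //.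
split=> // _; rewrite expr0 invr1 mulr1; apply: le_lt_trans (Z_le1 _ _) _.
by rewrite ltr1n.
Qed.

Lemma adj_mdist v w : adj v w ->
  mdist (cen v) (cen w) <= 2 * s ^- lev v + 2 * s ^- lev w.
Proof.
move=> [_ _ [x [/vballE vx /vballE wx]]].
apply: le_trans (metric_triangle _ x _) _.
by apply: lerD; [exact: ltW|rewrite metric_sym; exact: ltW].
Qed.

Lemma adj_lev v w : adj v w -> (lev v <= (lev w).+1)%N.
Proof. by move=> [_ + _]; lia. Qed.

Lemma lev_eq0 v : lev v = 0%N -> v = None.
Proof.
by case: v => [[a ha]|//] /= a0; have [] := set_mem ha; rewrite a0.
Qed.

Lemma vertex_sep v w : v != w -> lev v = lev w -> (0 < lev v)%N ->
  s ^- lev v <= mdist (cen v) (cen w).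
Proof.
case: v => [[[k z] kz]|//]; case: w => [[[k' z'] kz']|]; last first.
  by move=> _ /= e k0; exfalso; move: k0; rewrite e.
move=> neq /= e k0; move: kz' neq; rewrite -e => kz' neq.
have [_ /= h] := set_mem kz; have [_ /= h'] := set_mem kz'.
have [sep _] := net_max X k0; apply: sep => //.
apply: contraNN neq => /eqP zz'; apply/eqP; congr Some; apply: val_inj.
exact: (congr2 pair erefl zz').
Qed.

Lemma vertex_near k z : exists v, lev v = k /\ mdist (cen v) z <= s ^- k.
Proof.
case: k => [|k]; first by exists None; rewrite /= expr0 invr1; split.
have [x kx /ltW xz] := net_dense X z (ltn0Sn k).
have kx' : (k.+1, x) \in [set kz : nat * Z | (0 < kz.1)%N /\ net X kz.1 kz.2].
  by apply/mem_set.
by exists (Some (SigSub kx')).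
Qed.

Lemma gd_lev v w : (lev v <= lev w + gd v w)%N.
Proof.
have [u [<-]] := walk_gd v w; move: (gd _ w) => n <-.
elim: n => [|n IH] h; first by rewrite addn0.
have /IH le1 : forall i, (i < n)%N -> adj (u i) (u i.+1).
  by move=> i lti; apply: h; exact: leqW.
apply: leq_trans le1 _; have := adj_lev (h n (ltnSn n)); lia.
Qed.

(** One climbs level by level, each time to a vertex near [cen v] itself. Consecutive balls share
    this point, and the errors do not accumulate. *)
Lemma ancestor v k : (k <= lev v)%N -> exists u,
  [/\ lev u = k, mdist (cen u) (cen v) <= s ^- k & (gd v u <= lev v - k)%N].
Proof.
move=> kv; rewrite -(subKn kv); elim: (lev v - k)%N => [|n [u [uk uv vu]]].
  by exists v; rewrite subn0 mdistxx gdxx ltW.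
case: (ltnP n (lev v)) => nv; last first.
  by exists u; split; [lia| |lia]; have -> : (lev v - n.+1 = lev v - n)%N by lia.
have [u' [uk' uv']] := vertex_near (lev v - n.+1) (cen v).
exists u'; split=> //.
have /gd_adj uu' : adj u u'.
  split; first by apply/eqP => e; move: uk uk'; rewrite e; lia.
    by rewrite uk uk'; lia.
  exists (cen v); split; apply/vballE; rewrite ?uk ?uk'.
    by apply: le_lt_trans uv _; rewrite ltr_pMl ?ltr1n.
  by apply: le_lt_trans uv' _; rewrite ltr_pMl ?ltr1n.
have := gd_tri u v u'; lia.
Qed.

Lemma gd_root v : gd root v = lev v.
Proof.
apply/eqP; rewrite eqn_leq; apply/andP; split.
  have [u [/lev_eq0 -> _]] := ancestor (leq0n (lev v)).
  by rewrite gdC subn0.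
by rewrite gdC; exact: (gd_lev v root).
Qed.

Lemma gd_le_lev v w k : (k <= lev v)%N -> (k <= lev w)%N ->
  mdist (cen v) (cen w) < s ^- k -> (gd v w <= (lev v - k) + (lev w - k) + 1)%N.
Proof.
move=> kv kw vw.
have [u [uk uv vu]] := ancestor kv; have [u' [uk' uw wu]] := ancestor kw.
suff : (gd u u' <= 1)%N.
  have := gd_tri u v w; have := gd_tri u' u w; rewrite (gdC u' w); lia.
have [->|/eqP neq] := pselect (u = u'); first by rewrite gdxx.
apply: gd_adj; split=> //; first by rewrite uk uk' subrr normr0.
exists (cen v); split; apply/vballE; rewrite ?uk ?uk'.
  by apply: le_lt_trans uv _; rewrite ltr_pMl ?ltr1n.
apply: le_lt_trans (metric_triangle _ (cen w) _) _.
by rewrite mulr_natl mulr2n; apply: ler_ltD => //; rewrite metric_sym.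
Qed.

Lemma rho_ge_mdist v w : mdist (cen v) (cen w) < rho v w.
Proof. by rewrite /rho -addrA ltrDl addr_gt0. Qed.

Lemma rho_gt_l v w : s ^- lev v < rho v w.
Proof.
rewrite /rho (addrC (mdist _ _)) -addrA ltrDl.
by apply: ltr_wpDl => //; exact: mdist_ge0.
Qed.

Lemma rhoC v w : rho v w = rho w v.
Proof. by rewrite /rho metric_sym -!addrA; congr (_ + _); exact: addrC. Qed.

Lemma rho_gt0 v w : 0 < rho v w. Proof. exact: lt_trans (rho_gt_l v w). Qed.

Lemma rho_tri u v w : rho v w <= rho v u + rho u w.
Proof.
have := metric_triangle (cen v) (cen u) (cen w); rewrite /rho.
have := powN_gt0 (lev u); lra.
Qed.

Lemma dprod_root v w : (dprod root v w + gd v w = lev v + lev w)%N.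
Proof.
rewrite /dprod !gd_root subnK //; have := gd_tri root v w.
by rewrite (gdC v root) !gd_root.
Qed.

Lemma powNE n : s ^- n = q ^- (2 * n). Proof. by rewrite -q_sqr exprM. Qed.

(** With [k] such that [s ^- k.+1 < rho v w <= s ^- k], the ancestors at level [k] are equal or
    adjacent. Hence [dprod root v w] is at least [2 * k - 1], and the exponent 3 closes the gap to
    [2 * k.+1]. *)
Lemma rho_lower v w : 1 <= q ^+ 3 * rho v w * q ^+ dprod root v w.
Proof.
have rho0 := rho_gt0 v w; have D := dprod_root v w.
have [rho1|rho1] := ltP 1 (rho v w).
  rewrite -mulrA; apply: mulr_ege1; first by rewrite exprn_ege1 // ltW // q_gt1.
  by apply: mulr_ege1; [exact: ltW|rewrite exprn_ege1 // ltW // q_gt1].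
have ex : exists m, s ^- m < rho v w by exists (lev v); exact: rho_gt_l.
case: (ex_minnP ex) => -[|k] hk mink.
  by move: hk; rewrite expr0 invr1 ltNge rho1.
have kv := mink _ (rho_gt_l v w).
have kw : (k < lev w)%N by apply: mink; rewrite rhoC rho_gt_l.
have rhok : rho v w <= s ^- k.
  by rewrite leNgt; apply/negP => /mink; rewrite ltnn.
have := gd_le_lev (ltnW kv) (ltnW kw) (lt_le_trans (rho_ge_mdist v w) rhok) => le.
have le2 : (2 * k.+1 <= 3 + dprod root v w)%N by lia.
rewrite mulrAC -exprD; apply: le_trans (_ : q ^+ (2 * k.+1) * rho v w <= _).
  by rewrite -ler_pdivrMl ?exprn_gt0 // mulr1 -powNE ltW.
by rewrite ler_pM2r // ler_eXn2l // q_gt1.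
Qed.

(** Geometric series constant: [K * s = K + 2 * (s + 1)] absorbs one further step in [mdist_walk],
    as levels drop by at most one per step. *)
Let K : R := 2 * (s + 1) / (s - 1).

Let K0 : 0 < K.
Proof. by rewrite divr_gt0 ?subr_gt0 // mulr_gt0 // addr_gt0. Qed.

Let mdist_walk (u : nat -> V) n : (forall i, (i < n)%N -> adj (u i) (u i.+1)) ->
  mdist (cen (u 0%N)) (cen (u n)) <= K * s ^+ n * s ^- lev (u 0%N).
Proof.
elim: n => [|n IH] h.
  by rewrite mdistxx ltW // mulr_gt0 // mulr_gt0 // exprn_gt0.
have h' i : (i < n)%N -> adj (u i) (u i.+1) by move=> lti; apply: h; exact: leqW.
have lv i : (i <= n.+1)%N -> s ^- lev (u i) <= s ^+ i * s ^- lev (u 0%N).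
  move=> iN; rewrite ler_pdivlMr ?exprn_gt0 // mulrC ler_pdivrMr ?exprn_gt0 //.
  rewrite -exprD ler_eXn2l //.
  have := gd_lev (u 0%N) (u i); have := @gd_walk _ u n.+1 h 0 i ltac:(lia); lia.
apply: le_trans (metric_triangle _ (cen (u n)) _) _.
apply: le_trans (lerD (IH h') (adj_mdist (h n (ltnSn n)))) _.
have := lv n (leqW (leqnn n)); have := lv n.+1 (leqnn _).
have KE : K * s = K + 2 * (s + 1) by rewrite /K; field; rewrite subr_eq0 gt_eqF.
rewrite exprS => a b.
have -> : K * (s * s ^+ n) * s ^- lev (u 0%N) = (K * s) * (s ^+ n * s ^- lev (u 0%N)) by ring.
rewrite KE -mulrA in a *; lra.
Qed.

Let pow_le i n l l' : (2 * i + l' <= n.+1 + l)%N ->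
  s ^+ i * s ^- l * q ^+ (l + l') <= q ^+ n.+1.
Proof.
move=> h; rewrite mulrAC ler_pdivrMr ?exprn_gt0 // -q_sqr -!exprM -!exprD.
by rewrite ler_eXn2l ?q_gt1 //; lia.
Qed.

Lemma rho_upper : exists2 C, 0 < C & forall v w, rho v w * q ^+ dprod root v w <= C.
Proof.
have key (k m a b c d Q P : R) : 0 <= k -> 0 <= Q -> m <= k * a + k * b ->
    a * Q <= P -> b * Q <= P -> c * Q <= P -> d * Q <= P ->
    (m + c + d) * Q <= 2 * (k + 1) * P.
  move=> k0 Q0 /(ler_wpM2r Q0) le1 /(ler_wpM2l k0) le2 /(ler_wpM2l k0) le3.
  by move: le1 le2 le3; rewrite !mulrDl !mulrA; lra.
exists (2 * (K + 1) * q); first by rewrite !mulr_gt0 // addr_gt0.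
move=> v w; have D := dprod_root v w; set n := gd v w in D.
have [u [u0 un h _]] := geodesic v w; rewrite -/n in un h.
have lv := gd_lev v w; have lw := gd_lev w v; rewrite (gdC w v) -/n in lv lw.
(* This split balances the two halves: climbing [i] levels from [v] and [n - i] levels from [w]
   would end at the same level, up to rounding. *)
pose i := (n + lev v - lev w)./2.
have [i1 i2] : (2 * i + lev w <= n.+1 + lev v)%N /\ (2 * (n - i) + lev v <= n.+1 + lev w)%N.
  by lia.
have [i3 i4] : (2 * 0 + lev w <= n.+1 + lev v)%N /\ (2 * 0 + lev v <= n.+1 + lev w)%N.
  by lia.
have d1 : mdist (cen v) (cen (u i)) <= K * s ^+ i * s ^- lev v.
  rewrite -u0; apply: mdist_walk => j ji; apply: h; lia.
have d2 : mdist (cen w) (cen (u i)) <= K * s ^+ (n - i) * s ^- lev w.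
  have := @mdist_walk (fun j => u (n - j)%N) (n - i).
  rewrite subn0 un subKn; last lia.
  apply=> j ji; apply: adj_sym; rewrite -(@subnSK j n); last lia.
  apply: h; lia.
rewrite -(@ler_pM2r _ (q ^+ n)) ?exprn_gt0 // -mulrA -exprD D -[2 * _ * _ * _]mulrA -exprS.
have p1 : s ^+ i * s ^- lev v * q ^+ (lev v + lev w) <= q ^+ n.+1.
  exact: pow_le.
have p2 : s ^+ (n - i) * s ^- lev w * q ^+ (lev v + lev w) <= q ^+ n.+1.
  by rewrite (addnC (lev v)); exact: pow_le.
have p3 : s ^- lev v * q ^+ (lev v + lev w) <= q ^+ n.+1.
  by have := pow_le i3; rewrite expr0 mul1r.
have p4 : s ^- lev w * q ^+ (lev v + lev w) <= q ^+ n.+1.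
  by have := pow_le i4; rewrite expr0 mul1r (addnC (lev w)).
have Q0 : 0 <= q ^+ (lev v + lev w) by rewrite exprn_ge0 // ltW.
have : mdist (cen v) (cen w) <= K * (s ^+ i * s ^- lev v) + K * (s ^+ (n - i) * s ^- lev w).
  apply: le_trans (metric_triangle _ (cen (u i)) _) _; rewrite !mulrA.
  by apply: lerD => //; rewrite metric_sym.
by move=> le1; apply: key le1 p1 p2 p3 p4 => //; exact: ltW.
Qed.

(** By [rho_lower] and [rho_upper], the triangle inequality for [rho] becomes, on taking logarithms,
    the product inequality at the root; [hyp_base] does the rest. *)
Lemma filling_hyp : exists delta, hyperbolic V delta.
Proof.
have [C C0 hC] := rho_upper.
have [delta hd] : exists delta, 2 * C * q ^+ 3 <= q ^+ delta.
  by apply: exprn_unbounded; exact: q_gt1.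
exists (2 * delta)%N; apply: (@hyp_base _ delta root) => a b c.
rewrite -(@ler_eXn2l _ q) ?q_gt1 // exprD.
set m := minn _ _; set e := q ^+ dprod root a c.
have Em : q ^+ m <= q ^+ dprod root a b /\ q ^+ m <= q ^+ dprod root b c.
  by split; rewrite ler_eXn2l ?q_gt1 //; [exact: geq_minl|exact: geq_minr].
have bnd u v : q ^+ m <= q ^+ dprod root u v -> rho u v * q ^+ m <= C.
  by move=> /(ler_wpM2l (ltW (rho_gt0 u v))) /le_trans; apply.
have [/bnd ab /bnd bc] := Em.
have ac : rho a c * q ^+ m <= 2 * C.
  have : rho a c * q ^+ m <= (rho a b + rho b c) * q ^+ m.
    by rewrite ler_pM2r ?exprn_gt0 // rho_tri.
  by move=> /le_trans; apply; rewrite mulrDl mulr_natl mulr2n lerD.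
have e0 : 0 < e by rewrite exprn_gt0.
apply: le_trans (_ : e * (2 * C * q ^+ 3) <= _); last by rewrite ler_pM2l.
have := rho_lower a c; rewrite -/e => le1.
have m0 : 0 < q ^+ m by rewrite exprn_gt0.
have : q ^+ m <= q ^+ 3 * rho a c * e * q ^+ m by rewrite ler_peMl // ltW.
move=> /le_trans; apply.
have -> : q ^+ 3 * rho a c * e * q ^+ m = (e * q ^+ 3) * (rho a c * q ^+ m).
  by rewrite [q ^+ 3 * rho a c * e]mulrC !mulrA.
rewrite [leRHS](_ : _ = e * q ^+ 3 * (2 * C)); last by rewrite [2 * C * _]mulrC mulrA.
by rewrite ler_pM2l // mulr_gt0 // exprn_gt0.
Qed.

End filling_geometry.

(** * Bounded degree *)

Lemma bounded_seq_cover (T : choiceType) (A : set T) n :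
  (forall l : seq T, uniq l -> (forall x, x \in l -> A x) -> (size l <= n)%N) ->
  exists l : seq T, (size l <= n)%N /\ forall x, A x -> x \in l.
Proof.
move=> h.
pose P m := `[< exists l : seq T,
  [/\ uniq l, forall x, x \in l -> A x & size l = m] >].
have exP : exists m, P m by exists 0%N; apply/asboolP; exists [::]; split.
have ubP m : P m -> (m <= n)%N by move=> /asboolP[l [ul lA <-]]; exact: h.
case: (ex_maxnP exP ubP) => m /asboolP[l [ul lA lm]] mmax.
exists l; split; first exact: h.
move=> x Ax; apply/negPn/negP => xl.
have /mmax : P m.+1; last by rewrite ltnn.
apply/asboolP; exists (x :: l); split; rewrite /= ?ul ?xl ?lm //.
by move=> y; rewrite inE => /predU1P[->//|/lA].
Qed.

Section bounded_degree.
Variable G : graph.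

Lemma gd_ball_cover N :
  (forall v : G, exists l : seq G, (size l <= N)%N /\ forall w, adj v w -> w \in l) ->
  forall r, exists M, forall v : G, exists l : seq G, (size l <= M)%N /\
    forall w, (gd v w <= r)%N -> w \in l.
Proof.
move=> /choice[nb hnb]; elim=> [|r [M hM]].
  exists 1%N => v; exists [:: v]; split=> // w; rewrite leqn0 => /eqP vw.
  by have [u [u0 un _]] := walk_gd v w; rewrite inE -un vw u0.
exists (M + M * N)%N => v; have [l [lM hl]] := hM v.
have fl (l' : seq G) : (size (flatten (map nb l')) <= size l' * N)%N.
  elim: l' => [//|x l' IH] /=; rewrite size_cat mulSn leq_add //.
  by have [] := hnb x.
exists (l ++ flatten (map nb l)); split.
  by rewrite size_cat leq_add // (leq_trans (fl l)) // leq_mul2r lM orbT.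
move=> w; rewrite leq_eqVlt ltnS => /orP[/eqP vw|/hl]; last by rewrite mem_cat => ->.
have [u [u0 un h uu]] := geodesic v w; rewrite vw in un h uu.
rewrite mem_cat; apply/orP; right; apply/flattenP; exists (nb (u r)).
  by apply: map_f; apply: hl; rewrite -u0 uu ?subn0 //=.
by have [_] := hnb (u r); apply; rewrite -un; exact: h.
Qed.

End bounded_degree.

(** * Total boundedness and separated sets *)

Section metric_facts.
Context {R : realType} {T : metricType R}.

Lemma mball_open (x : T) (e : R) : open (ball x e).
Proof.
rewrite openE => y; rewrite ballEmdist /= => xy.
apply/nbhs_ballP; exists (e - mdist x y) => /=; first by rewrite subr_gt0.
move=> z; rewrite !ballEmdist /= => yz.
by apply: le_lt_trans (metric_triangle _ y _) _; rewrite -ltrBrDl.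
Qed.

Lemma totally_bounded (e : R) : compact [set: T] -> 0 < e ->
  exists l : seq T, forall x, exists2 y, y \in l & mdist y x < e.
Proof.
move=> cT e0; have [[x0 _]|nT] := pselect ([set: T] !=set0); last first.
  by exists [::] => x; case: nT; exists x.
pose pT : ptopologicalType := HB.pack T (isPointed.Build T x0).
have : @compact pT setT by exact: cT.
rewrite compact_cover => {}cT.
have [||D _ hD] := cT T setT (fun x => ball x e).
- by move=> x _; exact: mball_open.
- by move=> x _; exists x => //; exact: ballxx.
exists (finmap.enum_fset D) => x; have [y /= yD] := hD x I.
by rewrite ballEmdist /= => yx; exists y.
Qed.

Definition seq_separated (e : R) (l : seq T) := uniq l /\
  forall x y, x \in l -> y \in l -> x != y -> e <= mdist x y.

Lemma separated_card (e : R) : compact [set: T] -> 0 < e ->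
  exists N, forall l, seq_separated e l -> (size l <= N)%N.
Proof.
move=> cT e0; have e20 : 0 < e / 2 by rewrite divr_gt0.
have [m hm] := totally_bounded cT e20; exists (size m) => l [ul sl].
have /choice[f hf] : forall x, exists y, y \in m /\ mdist y x < e / 2.
  by move=> x; have [y] := hm x; exists y.
rewrite -(size_map f); apply: uniq_leq_size; last first.
  by move=> _ /mapP[x _ ->]; have [] := hf x.
rewrite map_inj_in_uniq // => x y xl yl fxy; apply/eqP/negPn/negP => xy.
have := sl x y xl yl xy; have [_ h1] := hf x; have [_ h2] := hf y.
have := metric_triangle x (f x) y; rewrite (metric_sym x (f x)).
rewrite fxy in h1 *; lra.
Qed.

End metric_facts.

(** * Doubling from Ahlfors regularity *)

Section doubling.
Context {R : realType} {Z : metricType R} (mu : {outer_measure set Z -> \bar R}).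
Hypothesis mu_regular : borel_regular mu.

(** The balls are disjoint, and open, hence Carathéodory measurable; they are split off [W] one at a
    time. *)
Lemma sum_separated_balls (e : R) (l : seq Z) (W : set Z) : seq_separated e l ->
  (forall x, x \in l -> ball x (e / 2) `<=` W) ->
  (\sum_(x <- l) mu (ball x (e / 2)) <= mu W)%E.
Proof.
elim: l W => [|x l IH] W [ul sl] lW; first by rewrite big_nil outer_measure_ge0.
move: ul => /=/andP[xl ul].
have meas : mu.-caratheodory (ball x (e / 2)).
  by apply: mu_regular.1; apply: sub_sigma_algebra; exact: mball_open.
rewrite big_cons (meas W); have -> : W `&` ball x (e / 2) = ball x (e / 2).
  by apply/setIidPr/lW; rewrite inE eqxx.
apply: leeD => //; apply: IH.
  by split=> // y z yl zl; apply: sl; rewrite inE ?yl ?zl orbT.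
move=> y yl z yz; split; first by apply: lW yz; rewrite inE yl orbT.
move: yz; rewrite !ballEmdist /= => yz xz.
have xy : x != y by apply: contraNneq xl => ->.
have := sl x y; rewrite !inE eqxx yl orbT => /(_ erefl erefl xy).
have := metric_triangle x z y; rewrite (metric_sym z y); lra.
Qed.

Lemma doubling : compact [set: Z] -> diam [set: Z] = 1 -> ahlfors_regular mu ->
  forall L : R, 0 < L -> exists N, forall (e : R) (z : Z) l, 0 < e -> seq_separated e l ->
    (forall x, x \in l -> mdist z x < L * e) -> (size l <= N)%N.
Proof.
move=> cZ dZ [Q [c [C [c0 C0 hmu]]]] L L0; rewrite dZ in hmu.
have L10 : 0 < L + 1 by rewrite addr_gt0.
have [N1 hN1] := separated_card cZ (divr_gt0 ltr01 L10).
pose N2 := Num.bound (C / c * (2 * (L + 1)) `^ Q).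
exists (maxn N1 N2) => e z l e0 sl lz; rewrite leq_max.
have [big|small] := ltP 1 ((L + 1) * e).
  apply/orP; left; apply: hN1; split; first by case: sl.
  move=> x y xl yl xy; apply: le_trans (sl.2 _ _ xl yl xy).
  by rewrite ler_pdivrMr // mulrC ltW.
apply/orP; right; have e20 : 0 < e / 2 by rewrite divr_gt0.
have e21 : e / 2 <= 1.
  apply: le_trans small; rewrite ler_pdivrMr //; nra.
have := @sum_separated_balls e l (ball z ((L + 1) * e)) sl.
have sub x : x \in l -> ball x (e / 2) `<=` ball z ((L + 1) * e).
  move=> /lz zx y; rewrite !ballEmdist /= => xy.
  have := metric_triangle z x y; lra.
move=> /(_ sub).
have Le0 : 0 < (L + 1) * e by rewrite mulr_gt0.
have /andP[_ up] := hmu z ((L + 1) * e) Le0 small.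
move=> /le_trans /(_ up).
have le1 : (\sum_(x <- l) (c * (e / 2) `^ Q)%:E <= \sum_(x <- l) mu (ball x (e / 2)))%E.
  apply: lee_sum => x _.
  by have /andP[] := hmu x (e / 2) e20 e21.
move=> /(le_trans le1); rewrite sumEFin lee_fin big_const_seq count_predT iter_addr_0.
have -> : (L + 1) * e = 2 * (L + 1) * (e / 2) by field.
rewrite (@powRM _ (2 * (L + 1)) (e / 2)) ?(ltW e20) ?mulr_ge0 ?(ltW L10) // => h.
have P0 : 0 < (e / 2) `^ Q by rewrite powR_gt0.
have le2 : (size l)%:R <= C / c * (2 * (L + 1)) `^ Q.
  rewrite -(@ler_pM2r _ (c * (e / 2) `^ Q)) ?mulr_gt0 // [(size l)%:R * _]mulr_natl.
  apply: le_trans h _; rewrite le_eqVlt; apply/orP; left; apply/eqP.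
  by field; rewrite gt_eqF.
rewrite -(ler_nat R); apply: le_trans le2 _; apply/ltW/archi_boundP.
by rewrite mulr_ge0 ?powR_ge0 // divr_ge0 ?ltW.
Qed.

End doubling.

Section filling_degree.
Variables (R : realType) (Z : metricType R) (X : hyperbolic_filling Z).
Variable mu : {outer_measure set Z -> \bar R}.
Hypotheses (mu_regular : borel_regular mu) (mu_ahlfors : ahlfors_regular mu).
Hypotheses (Z_compact : compact [set: Z]) (Z_diam : diam [set: Z] = 1).
Hypothesis Z_le1 : forall x y : Z, mdist x y <= 1.
Local Notation s := (scaling X).
Local Notation V := (filling_graph X).
Local Notation lev := (@vlevel R Z X).

Lemma filling_degree (z0 : Z) : exists N, forall v : V, exists l : seq V,
  (size l <= N)%N /\ forall w, adj v w -> w \in l.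
Proof.
have s1 := scaling_gt1 X; have s0 : 0 < s by exact: lt_trans s1.
(* A neighbour of [v] at level [j] has its center within [2 * s ^- lev v + 2 * s ^- j], at most
   [(2 * s + 2) * s ^- j], of that of [v]. *)
have L0 : 0 < 2 * s + 3 by rewrite addr_gt0 // mulr_gt0.
have [N hN] := doubling mu_regular Z_compact Z_diam mu_ahlfors L0.
exists (3 * maxn N 1)%N => v.
have lvl j : exists l : seq V, (size l <= maxn N 1)%N /\
    forall w, adj v w /\ lev w = j -> w \in l.
  apply: bounded_seq_cover => l ul hl; rewrite leq_max.
  case: (posnP j) => j0.
    apply/orP; right; case: l ul hl => [//|a [//|b l]] /= /andP[ab _] hl.
    have [_ a0] := hl a (mem_head _ _).
    have [_ b0] := hl b ltac:(by rewrite !inE eqxx orbT).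
    rewrite j0 in a0 b0.
    by move: ab; rewrite (lev_eq0 a0) (lev_eq0 b0) inE eqxx.
  apply/orP; left; rewrite -(size_map (cen z0)).
  have sep x y : x \in l -> y \in l -> x != y -> s ^- j <= mdist (cen z0 x) (cen z0 y).
    move=> /hl[_ xj] /hl[_ yj] xy; rewrite -xj; apply: vertex_sep => //.
      by rewrite xj yj.
    by rewrite xj.
  have sj : 0 < s ^- j by exact: powN_gt0.
  apply: (hN (s ^- j) (cen z0 v)) => //.
    split.
      rewrite map_inj_in_uniq // => x y xl yl xy; apply/eqP/negPn/negP => nxy.
      by have := sep _ _ xl yl nxy; rewrite xy mdistxx leNgt sj.
    move=> _ _ /mapP[x xl ->] /mapP[y yl ->] nxy; apply: sep => //.
    by apply: contraNneq nxy => ->.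
  move=> _ /mapP[x xl ->]; have [vx xj] := hl x xl.
  apply: le_lt_trans (adj_mdist z0 Z_le1 vx) _; rewrite xj.
  have : s ^- lev v <= s * s ^- j.
    have := adj_lev (adj_sym vx); rewrite xj => jv.
    rewrite ler_pdivlMr ?exprn_gt0 // mulrC ler_pdivrMr ?exprn_gt0 // -exprS.
    by rewrite ler_eXn2l.
  lra.
have [l1 [s1' h1]] := lvl (lev v).-1; have [l2 [s2' h2]] := lvl (lev v).
have [l3 [s3' h3]] := lvl (lev v).+1.
exists (l1 ++ l2 ++ l3); split; first by rewrite !size_cat; lia.
move=> w vw; rewrite !mem_cat; have := adj_lev vw; have := adj_lev (adj_sym vw) => a b.
have [e|[e|e]] : lev w = (lev v).-1 \/ lev w = lev v \/ lev w = (lev v).+1 by lia.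
- by rewrite h1.
- by rewrite h2 ?orbT.
- by rewrite h3 ?orbT.
Qed.

End filling_degree.

(** * Weak norms and admissible functions *)

Section weak_bound.
Context {R : realType} {S : choiceType}.
Implicit Types f g : S -> R.

Lemma counting_leP (A : set S) (r : R) : (counting A <= r%:E)%E <->
  exists l : seq S, (size l)%:R <= r /\ forall x, A x -> x \in l.
Proof.
rewrite /counting; split.
  case: asboolP => // finA; rewrite lee_fin => le.
  exists (finmap.enum_fset (fset_set A)); split => // x Ax.
  by rewrite -[_ \in _]/(x \in fset_set A) in_fset_set // inE.
move=> [l [lr Al]].
have finA : finite_set A.
  by apply: (@sub_finite_set _ _ [set` l]) => //; exact: finite_seq.
rewrite asboolT // lee_fin; apply: le_trans lr; rewrite ler_nat.
rewrite -[X in (X <= _)%N]/(size (finmap.enum_fset (fset_set A))).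
apply: uniq_leq_size; first exact: finmap.fset_uniq.
move=> x; rewrite -[_ \in _]/(x \in fset_set A) in_fset_set // inE.
exact: Al.
Qed.

(** [M] stands for the [p]-th power of the constant in [weak_norm]. Covering lists replace
    cardinals, since they are easily concatenated. *)
Definition weak_bound (p M : R) f := forall lam, 0 < lam ->
  exists l : seq S, (size l)%:R <= M / lam `^ p /\ forall x, lam < f x -> x \in l.

Lemma weak_normP p f : (weak_norm p f < +oo)%E ->
  exists2 M, 0 < M & weak_bound p M f.
Proof.
move=> /ereal_inf_lt[_ [C [C0 hC] <-] _]; exists (C `^ p); first exact: powR_gt0.
by move=> lam lam0; apply/(@counting_leP [set x | lam < f x])/hC.
Qed.

Lemma weak_norm_le p M f : 0 < p -> 0 < M -> weak_bound p M f ->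
  (poweR (weak_norm p f) p <= M%:E)%E.
Proof.
move=> p0 M0 hM.
have ME : (M `^ p^-1) `^ p = M by rewrite -powRrM mulVf ?gt_eqF // powRr1 // ltW.
rewrite -ME -poweR_EFin; apply: gt0_ler_poweR.
- exact: ltW.
- rewrite in_itv /= leey andbT; apply/ereal_infP => _ [C [C0 _] <-].
  by rewrite lee_fin ltW.
- by rewrite in_itv /= leey andbT lee_fin powR_ge0.
apply: ereal_inf_lbound; exists (M `^ p^-1) => //; split; first exact: powR_gt0.
by move=> lam lam0; rewrite ME; apply/counting_leP/hM.
Qed.

Lemma weak_bound_max p M N f g : weak_bound p M f -> weak_bound p N g ->
  weak_bound p (M + N) (fun x => Num.max (f x) (g x)).
Proof.
move=> hf hg lam lam0; have [l [lM hl]] := hf _ lam0; have [m [mN hm]] := hg _ lam0.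
exists (l ++ m); split; first by rewrite size_cat natrD mulrDl lerD.
by move=> x; rewrite lt_max mem_cat => /orP[/hl ->|/hm ->]; rewrite ?orbT.
Qed.

Lemma weak_bound0 p M : 0 < M -> weak_bound p M (fun=> 0).
Proof.
move=> M0 lam lam0; exists [::]; split; first by rewrite divr_ge0 ?powR_ge0 // ltW.
by move=> x; rewrite ltNge ltW.
Qed.

(** At the level with [p]-th power [2 * M], the superlevel set has at most 1/2 element. The bound
    makes the suprema in [pulled] finite. *)
Lemma weak_bound_bounded p M f : 0 < p -> 0 < M -> weak_bound p M f ->
  exists B, forall x, f x <= B.
Proof.
move=> p0 M0 hf; exists ((2 * M) `^ p^-1) => x; rewrite leNgt; apply/negP => lt.
have B0 : 0 < (2 * M) `^ p^-1 by rewrite powR_gt0 // mulr_gt0.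
have [l [lM hl]] := hf _ B0; have := hl _ lt; case: l lM {hl} => [//|a l] lM _.
have M2 : 0 < 2 * M by rewrite mulr_gt0.
move: lM; rewrite -powRrM mulVf ?gt_eqF // powRr1 ?(ltW M2) //.
have -> : M / (2 * M) = 2^-1 by field; rewrite gt_eqF.
move=> le; have : 1 <= 2^-1 :> R by apply: le_trans le; rewrite ler1n.
by rewrite invf_ge1 // leNgt ltr1n.
Qed.

End weak_bound.

(** * Admissibility for a relation between limits *)

Section crossing.
Context {R : realType} {Z : metricType R}.
Variable X : hyperbolic_filling Z.
Local Notation V := (filling_graph X).
Local Notation E := (edge V).

(** [P] takes the limit at minus infinity first. A relation, unlike a pair of open sets, can also
    express that the limits are [eta]-apart. *)
Definition crossing (tau : E -> R) (P : Z -> Z -> Prop) :=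
  forall (v : int -> V) (e : int -> E) a b, joins v e ->
    path_cvg (fun k => v (- k%:Z)) a -> path_cvg (fun k => v k%:Z) b -> P a b ->
    (1 <= \esum_(k in [set: int]) (tau (e k))%:E)%E.

Lemma crossing_le tau tau' (P : Z -> Z -> Prop) : (forall e, 0 <= tau e) ->
  (forall e, tau e <= tau' e) -> crossing tau P -> crossing tau' P.
Proof.
move=> t0 tt' h v e a b ve va vb ab; apply: le_trans (h v e a b ve va vb ab) _.
by apply: le_esum => k _; rewrite lee_fin.
Qed.

Lemma wcap_lty p A B : 0 < p -> (wcap X p A B < +oo)%E ->
  exists tau M, [/\ 0 < M, forall e, 0 <= tau e, weak_bound p M tau &
    crossing tau (fun a b => A a /\ B b)].
Proof.
move=> p0 /ereal_inf_lt[_ [tau [tau0 adm] <-]].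
move=> /lty_poweRy; rewrite gt_eqF // => /(_ isT) /weak_normP[M M0 hM].
exists tau, M; split=> // v e a b ve va vb ab; apply: (adm v) => //.
by exists a, b; split=> //; left.
Qed.

Lemma wcap_le p A B tau M : 0 < p -> 0 < M -> (forall e, 0 <= tau e) ->
  weak_bound p M tau -> crossing tau (fun a b => (A a /\ B b) \/ (B a /\ A b)) ->
  (wcap X p A B <= M%:E)%E.
Proof.
move=> p0 M0 tau0 hM h; apply: ge_ereal_inf; exists (poweR (weak_norm p tau) p).
  exists tau => //; split=> // v e ve [a [b [va vb ab]]].
  exact: (h v e a b).
exact: weak_norm_le.
Qed.

(* The maximum over finitely many pairs of small balls covering the pairs of
   points at distance at least [eta]. *)
Lemma uniform_crossing p (eta eps : R) : 0 < p -> compact [set: Z] -> 0 < eps ->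
  (forall x y, eta <= mdist x y + 2 * eps ->
    (wcap X p (ball x eps) (ball y eps) < +oo)%E) ->
  exists tau M, [/\ 0 < M, forall e, 0 <= tau e, weak_bound p M tau &
    crossing tau (fun a b => eta <= mdist a b)].
Proof.
move=> p0 cZ eps0 h.
have fam (l : seq (Z * Z)) : exists tau M,
  [/\ 0 < M, forall e, 0 <= tau e, weak_bound p M tau &
   forall x y, (x, y) \in l -> eta <= mdist x y + 2 * eps ->
     crossing tau (fun a b => ball x eps a /\ ball y eps b)].
  elim: l => [|[x y] l [tau [M [M0 tau0 tauM htau]]]].
    by exists (fun=> 0), 1; split=> //; exact: weak_bound0.
  have [xy|xy] := pselect (eta <= mdist x y + 2 * eps); last first.
    by exists tau, M; split=> // x' y'; rewrite inE => /predU1P[[-> ->]//|]; exact: htau.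
  have [tau' [M' [M'0 tau'0 tau'M htau']]] := wcap_lty p0 (h x y xy).
  exists (fun e => Num.max (tau e) (tau' e)), (M + M'); split.
  - exact: addr_gt0.
  - by move=> e; rewrite le_max tau0.
  - exact: weak_bound_max.
  move=> x' y'; rewrite inE => /predU1P[[-> ->] _|xyl xy'].
    by apply: crossing_le htau' => // e; rewrite le_max lexx orbT.
  by apply: crossing_le (htau _ _ xyl xy') => // e; rewrite le_max lexx.
have [l hl] := totally_bounded cZ eps0.
have [tau [M [M0 tau0 tauM htau]]] := fam [seq (x, y) | x <- l, y <- l].
exists tau, M; split=> // v e a b ve va vb ab.
have [x xl xa] := hl a; have [y yl yb] := hl b.
apply: (htau x y _ _ v e a b ve va vb).
- by apply/allpairsP; exists (x, y).
- have := metric_triangle a x b; have := metric_triangle x y b.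
  rewrite (metric_sym a x); lra.
- by rewrite !ballEmdist.
Qed.

End crossing.

(** * Paths and their limits *)

Section series.
Context {R : realType}.

Lemma esum_int (f : int -> \bar R) : (forall k, 0 <= f k)%E ->
  \esum_(k in [set: int]) f k =
  (\sum_(n <oo) f (Posz n) + \sum_(n <oo) f (Negz n))%E.
Proof.
move=> f0; rewrite (esumID (range Posz)) // !setTI.
have -> : ~` range Posz = range Negz.
  apply/seteqP; split=> [[n|n] //= h|_ [n _ <-] /= [m _ //]].
    by case: h; exists n.
  by exists n.
congr (_ + _)%E.
  by rewrite esum_image ?nneseries_esumT // => m n _ _ [].
by rewrite esum_image ?nneseries_esumT // => m n _ _ [].
Qed.

Lemma nneseries_le_partial (f g : nat -> R) : (forall n, 0 <= f n) ->
  (forall n, 0 <= g n) ->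
  (forall m, exists n, \sum_(0 <= i < m) f i <= \sum_(0 <= i < n) g i) ->
  (\sum_(n <oo) (f n)%:E <= \sum_(n <oo) (g n)%:E)%E.
Proof.
move=> f0 g0 h; apply: lime_le.
  by apply: is_cvg_nneseries => n _ _; rewrite lee_fin.
apply: nearW => m; have [n le] := h m; rewrite sumEFin.
apply: (@le_trans _ _ (\sum_(0 <= i < n) (g i)%:E)%E); first by rewrite sumEFin lee_fin.
by apply: nneseries_lim_ge => i _ _; rewrite lee_fin.
Qed.

End series.

(** * Turning a coarse path into a path *)

Section concatenation.
Variables (G : graph) (w : nat -> G) (N : nat).
Hypothesis nbr : forall v : G, exists v', adj v v'.
Hypothesis wN : forall k, (gd (w k) (w k.+1) <= N)%N.

(** A path cannot stay at a vertex, so for equal endpoints the walk goes to a neighbour and back;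
    this accounts for [N.+2]. *)
Lemma positive_walk (v v' : G) : (gd v v' <= N)%N -> exists n (a : nat -> G),
  [/\ (0 < n <= N.+2)%N, a 0%N = v, a n = v' & forall i, (i < n)%N -> adj (a i) (a i.+1)].
Proof.
move=> vN; case: (posnP (gd v v')) => [vv0|vv0]; last first.
  have [a [a0 an h]] := walk_gd v v'; exists (gd v v'), a; split=> //; lia.
have -> : v' = v by have [a [a0 an _]] := walk_gd v v'; rewrite -an vv0.
have [x vx] := nbr v; exists 2, (fun i => if i is 1 then x else v); split=> //.
by move=> [|[|]] // _; exact: adj_sym.
Qed.

(* The state [(k, j)] means: [j] steps along the walk from [w k] to [w k.+1]. *)
Lemma concat : exists (u : nat -> G) (idx : nat -> nat), [/\ u 0%N = w 0%N,
  forall m, adj (u m) (u m.+1),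
  forall m, (gd (w (idx m)) (u m) <= N.+2)%N,
  forall m, (m <= N.+2 * (idx m).+1)%N &
  forall (R : realType) (g : nat -> R), (forall k, 0 <= g k) -> forall m,
    \sum_(0 <= i < m) g (idx i) <= \sum_(0 <= k < (idx m).+1) N.+2%:R * g k].
Proof.
have /choice[n /choice[a ha]] := fun k => positive_walk (wN k).
have n0 k : (0 < n k <= N.+2)%N by have [] := ha k.
pose next (kj : nat * nat) := if (kj.2.+1 < n kj.1)%N then (kj.1, kj.2.+1) else (kj.1.+1, 0%N).
pose st m := iter m next (0%N, 0%N).
have stS m : st m.+1 = next (st m) by [].
have stlt m : ((st m).2 < n (st m).1)%N.
  elim: m => [|m IH]; first by case/andP: (n0 0%N).
  rewrite stS /next; case: ifP => //= _; by case/andP: (n0 (st m).1.+1).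
pose u m := a (st m).1 (st m).2.
have uS m : u m.+1 = a (st m).1 (st m).2.+1.
  rewrite /u stS /next; case: ifP => //= /negbT.
  rewrite -leqNgt => le; have -> : (st m).2.+1 = n (st m).1 by have := stlt m; lia.
  by have [_ _ ->] := ha (st m).1; have [_ -> _] := ha (st m).1.+1.
exists u, (fun m => (st m).1); split.
- by rewrite /u /=; have [_ ->] := ha 0%N.
- by move=> m; rewrite uS; have [_ _ _] := ha (st m).1; apply.
- move=> m; have [_ a0 _ h] := ha (st m).1; rewrite -a0.
  have /(gd_walk h) : (0 <= (st m).2 <= n (st m).1)%N by rewrite leq0n ltnW.
  by move=> /leq_trans; apply; have := stlt m; have := n0 (st m).1; lia.
- suff H m : (m <= N.+2 * (st m).1 + (st m).2)%N.
    move=> m; apply: leq_trans (H m) _; rewrite mulnS addnC leq_add2r.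
    by have := stlt m; have := n0 (st m).1; lia.
  elim: m => [//|m IH].
  rewrite stS /next; case: ifP => /= _; first by rewrite addnS.
  by have := stlt m; have := n0 (st m).1; nia.
move=> R g g0 m.
(* Invariant: each completed block is charged at most [N.+2] times, the current one [(st m).2]
   times. *)
apply: (@le_trans _ _ (\sum_(0 <= k < (st m).1) N.+2%:R * g k + (st m).2%:R * g (st m).1)).
  elim: m => [|m IH]; first by rewrite !big_nil mul0r addr0.
  rewrite big_nat_recr //=; apply: le_trans (lerD IH (lexx _)) _.
  rewrite /next; case: ifP => /= _.
    by rewrite -[(st m).2.+1%:R]natr1 mulrDl mul1r addrA.
  rewrite big_nat_recr //= mul0r addr0 -addrA lerD2l -{2}[g _]mul1r -mulrDl natr1.
  by rewrite ler_wpM2r // ler_nat; have := stlt m; have := n0 (st m).1; lia.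
rewrite big_nat_recr //= lerD2l ler_wpM2r // ler_nat.
by have := stlt m; have := n0 (st m).1; lia.
Qed.

End concatenation.

(** * Convergence to points of [Z] *)

Section boundary.
Variables (R : realType) (Z : metricType R) (X : hyperbolic_filling Z) (z0 : Z).
Hypothesis Z_le1 : forall x y : Z, mdist x y <= 1.
Hypothesis Z_compact : compact [set: Z].
Local Notation s := (scaling X).
Local Notation V := (filling_graph X).
Local Notation lev := (@vlevel R Z X).
Local Notation root := (None : V).
Local Notation cen := (@cen R Z X z0).
Local Notation rho := (@rho R Z X z0).
Local Notation q := (sqrt_scaling X).

(** The extension of [rho] to a boundary point, regarded as a vertex of infinite level. *)
Definition bdist (v : V) (z : Z) : R := mdist (cen v) z + s ^- lev v.

Definition tends (v : nat -> V) z := forall eps, 0 < eps ->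
  exists n, forall k, (n <= k)%N -> bdist (v k) z < eps.

Lemma path_cvgP (v : nat -> V) z : path_cvg v z <-> tends v z.
Proof.
have s1 := scaling_gt1 X; split.
  move=> [c1 c2] eps eps0; have e20 : 0 < eps / 2 by rewrite divr_gt0.
  have /cvgrPdist_lt/(_ eps eps0) c2' := c2.
  have := c1 _ e20; case=> n1 _ h1; case: c2' => n2 _ h2.
  exists (maxn n1 n2) => k; rewrite geq_max => /andP[k1 k2].
  have [c cE cz] := h1 k k1; have := h2 k k2; rewrite /= sub0r normrN.
  rewrite /vradius ger0_norm ?mulr_ge0 ?ltW ?powN_gt0 // => lt.
  rewrite /bdist /Defs.vlevel /cen cE /= in lt *; lra.
move=> h; split.
  (* The minimum with 1 excludes the root, which has no center: [bdist] is at least 1 there. *)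
  move=> eps eps0; have m0 : 0 < Num.min eps 1 by rewrite lt_min eps0 ltr01.
  have [n hn] := h _ m0; exists n => // k /= /hn; rewrite lt_min /bdist => /andP[k1 k2].
  case: (v k) k1 k2 => [a|] /= k1 k2.
    by exists (val a).2 => //; apply: le_lt_trans k1; rewrite lerDl ltW // powN_gt0.
  by exfalso; move: k2; rewrite expr0 invr1 ltNge lerDr mdist_ge0.
apply/cvgrPdist_lt => eps eps0; have e20 : 0 < eps / 2 by rewrite divr_gt0.
have [n hn] := h _ e20; exists n => // k /= /hn.
rewrite sub0r normrN /vradius ger0_norm ?mulr_ge0 ?ltW ?powN_gt0 // /bdist.
have := mdist_ge0 (cen (v k)) z; lra.
Qed.

Lemma rho_bdist v w z : rho v w <= bdist v z + bdist w z.
Proof.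
have := metric_triangle (cen v) z (cen w); rewrite /rho /bdist (metric_sym z); lra.
Qed.

Lemma bdist_rho v w z : bdist v z <= rho v w + bdist w z.
Proof.
have := metric_triangle (cen v) (cen w) z; rewrite /rho /bdist.
have := powN_gt0 X (lev w); lra.
Qed.

Lemma mdist_bdist v w z z' : rho v w <= mdist z z' + bdist v z + bdist w z'.
Proof.
have := metric_triangle (cen v) z (cen w); have := metric_triangle z z' (cen w).
rewrite /rho /bdist (metric_sym z' (cen w)); lra.
Qed.

Lemma cauchy_tends (w : nat -> V) : (forall eps, 0 < eps -> exists n,
   forall k l, (n <= k)%N -> (n <= l)%N -> rho (w k) (w l) < eps) ->
  exists z, tends w z.
Proof.
move=> cw.
have [z [_ zc]] := Z_compact (F := (cen \o w) @ \oo) _ filterT.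
exists z => eps eps0; have e20 : 0 < eps / 2 by rewrite divr_gt0.
have [n hn] := cw _ e20; exists n => k nk.
have A : (cen \o w @ \oo) [set cen (w l) | l in [set l | (n <= l)%N]].
  by exists n => // l /= nl; exists l.
have [_ [[l nl <-]]] := zc _ _ A (nbhsx_ballx z _ e20).
rewrite ballEmdist /= => zl; have := hn k l nk nl.
have := metric_triangle (cen (w k)) (cen (w l)) z; rewrite (metric_sym (cen (w l)) z).
rewrite /rho /bdist; have := powN_gt0 X (lev (w l)); lra.
Qed.

(** If [y] is within [N] steps of [x], then [dprod root y x] is at least [2 * lev x - 2 * N], so by
    [rho_upper] [rho y x] is at most a constant times [s ^- lev x]. *)
Lemma tends_near (N : nat) (w u : nat -> V) (idx : nat -> nat) z : tends w z ->
  (forall m, (gd (w (idx m)) (u m) <= N)%N) ->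
  (forall k, exists n, forall m, (n <= m)%N -> (k <= idx m)%N) -> tends u z.
Proof.
move=> wz near idxy eps eps0; have [C C0 hC] := rho_upper X z0 Z_le1.
have q1 := q_gt1 X; have q0 : 0 < q by exact: lt_trans q1.
have D0 : 0 < C * q ^+ (2 * N) + 1 by rewrite addr_gt0 // mulr_gt0 // exprn_gt0.
have [k hk] := wz _ (divr_gt0 eps0 D0).
have [n hn] := idxy k; exists n => m /hn/hk lt.
apply: le_lt_trans (bdist_rho _ (w (idx m)) z) _.
set x := w (idx m) in lt *; set y := u m; have xy : (gd x y <= N)%N := near m.
have : rho y x <= C * q ^+ (2 * N) * s ^- lev x.
  have := hC y x; have := dprod_root z0 Z_le1 y x.
  rewrite powNE ler_pdivlMr ?exprn_gt0 // => dE.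
  rewrite gdC in dE; have := gd_lev x y => lxy.
  have le : (2 * lev x <= dprod root y x + 2 * N)%N by lia.
  move=> /(ler_wpM2r (ltW (exprn_gt0 (2 * N) q0))); apply: le_trans.
  by rewrite -mulrA -exprD ler_wpM2l ?(ltW (rho_gt0 z0 y x)) // ler_eXn2l.
have : s ^- lev x <= bdist x z by rewrite lerDr mdist_ge0.
move: lt; rewrite ltr_pdivlMr // mulrC mulrDl mul1r => lt le1 le2.
apply: le_lt_trans lt; rewrite lerD2r; apply: le_trans le2 _.
by rewrite ler_wpM2l // mulr_ge0 ?exprn_ge0 ?ltW.
Qed.

End boundary.

(** * Pulling back along a quasi-isometry *)

Section pullback.
Variables (R : realType) (Z : metricType R) (X : hyperbolic_filling Z) (z0 : Z).
Hypothesis Z_le1 : forall x y : Z, mdist x y <= 1.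
Hypothesis Z_compact : compact [set: Z].
Local Notation s := (scaling X).
Local Notation V := (filling_graph X).
Local Notation E := (edge V).
Local Notation lev := (@vlevel R Z X).
Local Notation root := (None : V).
Local Notation rho := (@rho R Z X z0).
Local Notation bdist := (@bdist R Z X z0).
Local Notation tends := (@tends R Z X z0).
Local Notation q := (sqrt_scaling X).

Lemma filling_nbr (v : V) : exists v', adj v v'.
Proof.
have [w [wv wz]] := vertex_near X z0 Z_le1 (lev v).+1 (cen z0 v); exists w; split.
- by apply/eqP => e; move: wv; rewrite -e; lia.
- by rewrite wv; lia.
exists (cen z0 v); split; apply/(vballE z0 Z_le1).
  by rewrite mdistxx mulr_gt0 // powN_gt0.
by apply: le_lt_trans wz _; rewrite -wv ltr_pMl ?powN_gt0 // ltr1n.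
Qed.

(** Small [rho] means large product at the root, which [dprod_qie] transports to [F root]. Moving
    back to the root costs [2 * g], so [d] depends on [F]; this only serves the existence of limits
    of image paths. *)
Lemma qie_rho L (F : V -> V) : qie L F -> forall eps, 0 < eps ->
  exists2 d, 0 < d & forall v w, rho v w < d -> rho (F v) (F w) < eps.
Proof.
move=> qF eps eps0; have q1 := q_gt1 X; have q0 : 0 < q by exact: lt_trans q1.
have [delta hd] := filling_hyp X z0 Z_le1.
have [K hK] := dprod_qie L hd.
have [C C0 hC] := rho_upper X z0 Z_le1.
have [n hn] := exprn_unbounded (C / eps + 1) q1.
pose g := gd (F root) root; pose m := (K * (n + 2 * g) + K)%N.
exists (q ^+ (3 + m))^-1; first by rewrite invr_gt0 exprn_gt0.
move=> v w lt; have dm : (m < dprod root v w)%N.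
  rewrite ltnNge; apply/negP => le.
  have := rho_lower z0 Z_le1 v w; apply/negP; rewrite -ltNge mulrAC -exprD.
  rewrite -(mulVf (_ : q ^+ (3 + m) != 0)) ?gt_eqF ?exprn_gt0 // [ltRHS]mulrC.
  apply: (@le_lt_trans _ _ (q ^+ (3 + m) * rho v w)).
    by rewrite ler_wpM2r ?(ltW (rho_gt0 _ _ _)) // ler_eXn2l // leq_add2l.
  by rewrite ltr_pM2l // exprn_gt0.
have ge : (n <= dprod root (F v) (F w))%N.
  have := hK F qF root v w.
  have : (dprod (F root) (F v) (F w) <= dprod root (F v) (F w) + 2 * g)%N.
    have := gd_tri root (F root) (F v); have := gd_tri root (F root) (F w).
    by rewrite /dprod /g; lia.
  set D := dprod (F root) _ _ => le1 le2.
  rewrite leqNgt; apply/negP => lt1.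
  have : (K * D <= K * (n + 2 * g))%N by rewrite leq_mul2l; apply/orP; right; lia.
  rewrite /m in dm; lia.
have := hC (F v) (F w); rewrite -ler_pdivlMr ?exprn_gt0 //.
move=> /le_lt_trans; apply; rewrite ltr_pdivrMr ?exprn_gt0 // mulrC -ltr_pdivrMr //.
apply: lt_le_trans (_ : q ^+ n <= _); last by rewrite ler_eXn2l.
by apply: lt_le_trans hn; rewrite ltrDl.
Qed.

Lemma image_tends L (F : V -> V) (v : nat -> V) a : qie L F -> tends v a ->
  exists a', tends (F \o v) a'.
Proof.
move=> qF va; apply: cauchy_tends => // eps eps0.
have [d d0 hd] := qie_rho qF eps0; have d20 : 0 < d / 2 by rewrite divr_gt0.
have [n hn] := va _ d20; exists n => k l nk nl; apply: hd.
apply: le_lt_trans (rho_bdist _ _ _ a) _.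
by have := hn k nk; have := hn l nl; lra.
Qed.

Lemma edge_gd (e : E) (x y : V) : val e x -> val e y -> (gd x y <= 1)%N.
Proof.
have [a [b [ab ->]]] := set_mem (valP e).
by move=> [->|->] [->|->]; rewrite ?gdxx ?gd_adj //; exact: adj_sym.
Qed.

Section pulled.
Variables (p M B : R) (L D : nat) (tau : E -> R) (F : V -> V).
Hypotheses (tau_ge0 : forall e, 0 <= tau e) (tau_le : forall e, tau e <= B).
Hypothesis (qF : qie L F).
(** Images of adjacent vertices are at distance at most [2 * L]; [concat] then adds 2. *)
Let N := (2 * L).+2.

Definition near_edge (e e' : E) :=
  exists x y, [/\ val e x, val e' y & (gd (F x) y <= N)%N].

(* The factor [N]: at most [N] edges of an image path are charged to one edge. *)
Definition pulled (e : E) : R := N%:R * sup [set tau e' | e' in near_edge e].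

Let sup_tau e e' : near_edge e e' -> tau e' <= sup [set tau e' | e' in near_edge e].
Proof.
by move=> ee'; apply: ub_le_sup; [exists B => _ [x _ <-]|exists e'].
Qed.

Let sup_ge0 e : 0 <= sup [set tau e' | e' in near_edge e].
Proof.
have [[e' ee']|n] := pselect (exists e', near_edge e e').
  exact: le_trans (sup_tau ee').
have -> : [set tau e' | e' in near_edge e] = set0; last by rewrite sup0.
by rewrite -subset0 => x [e' ee' _]; apply: n; exists e'.
Qed.

Lemma pulled_ge0 e : 0 <= pulled e. Proof. by rewrite mulr_ge0. Qed.

(** Images of ends of two edges near [e'] are at distance at most [2 * N + 1], so both ends of every
    such edge lie in one ball of controlled radius, and a pair of ends determines the edge. *)
Lemma near_edge_card : (forall v : V, exists l : seq V, (size l <= D)%N /\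
    forall w, (gd v w <= (L * (2 * N + 1) + L).+1)%N -> w \in l) ->
  forall e', exists l : seq E, (size l <= D * D)%N /\
    forall e, near_edge e e' -> e \in l.
Proof.
move=> hD e'.
have [[e0 [x0 [y0 [ex0 ey0 xy0]]]]|n] := pselect (exists e, near_edge e e');
  last first.
  by exists [::]; split=> // e ee'; exfalso; apply: n; exists e.
have [l [lD hl]] := hD x0.
pose mk (ab : V * V) : E := xget e0 [set e | val e = [set ab.1; ab.2]].
exists (map mk [seq (a, b) | a <- l, b <- l]); split.
  by rewrite size_map size_allpairs leq_mul.
move=> e [x [y [ex ey xy]]].
have xx0 : (gd x0 x <= L * (2 * N + 1) + L)%N.
  have [_] := qF x0 x; move=> /leq_trans; apply; rewrite leq_add2r leq_mul2l.
  apply/orP; right; have := edge_gd ey0 ey.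
  have := gd_tri y0 (F x0) (F x); have := gd_tri y y0 (F x).
  by rewrite (gdC y (F x)); lia.
have inl z : val e z -> z \in l.
  by move=> ez; apply: hl; have := edge_gd ex ez; have := gd_tri x x0 z; lia.
have [a [b [ab eE]]] := set_mem (valP e).
have -> : e = mk (a, b).
  by apply: val_inj; rewrite /mk; case: xgetP => [e1 _ /= ->|/(_ e)] //.
apply: map_f; apply/allpairsP; exists (a, b); split=> //=; apply: inl; rewrite eE.
  by left.
by right.
Qed.

(** Where [pulled] exceeds [lam], some near edge has [tau] above [lam / N], and each edge is near at
    most [K] edges. Using [K.+1] keeps the constant positive. *)
Lemma pulled_weak_bound K : (forall e', exists l : seq E, (size l <= K)%N /\
    forall e, near_edge e e' -> e \in l) -> 0 < M ->
  weak_bound p M tau -> weak_bound p (K.+1%:R * M * N%:R `^ p) pulled.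
Proof.
move=> /choice[fib hfib] M0 hM lam lam0.
have N0 : 0 < N%:R :> R by rewrite ltr0n.
have lN0 : 0 < lam / N%:R by rewrite divr_gt0.
have [l [lM hl]] := hM _ lN0; exists (flatten (map fib l)); split.
  have fl (l' : seq E) : (size (flatten (map fib l')) <= K.+1 * size l')%N.
    elim: l' => [//|x l' IH] /=; rewrite size_cat mulnS leq_add //.
    by have [le _] := hfib x; exact: leq_trans le _.
  apply: (@le_trans _ _ (K.+1 * size l)%:R); first by rewrite ler_nat fl.
  have -> : lam `^ p = (lam / N%:R) `^ p * N%:R `^ p.
    by rewrite -powRM ?(ltW lN0) // divfK // gt_eqF.
  rewrite natrM -!mulrA ler_wpM2l //; apply: le_trans lM _.
  have := powR_gt0 p N0; have := powR_gt0 p lN0.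
  move: (_ `^ p) (_ `^ p) => x y x0 y0.
  rewrite le_eqVlt; apply/orP; left; apply/eqP; field.
  by rewrite !gt_eqF.
move=> e; rewrite /pulled mulrC -ltr_pdivrMr // => lt.
have ne : [set tau e' | e' in near_edge e] !=set0.
  apply/set0P/eqP => s0; move: lt; rewrite s0 sup0 ltNge.
  by rewrite (ltW lN0).
have [_ [e' ee' <-] /hl e'l] := sup_gt ne lt.
apply/flattenP; exists (fib e'); first exact: map_f.
by have [_] := hfib e'; apply.
Qed.

Lemma adj_edge (v w : V) : adj v w -> exists e : E, val e = [set v; w].
Proof.
move=> vw; have h : [set v; w] \in @edge_set V by apply/mem_set; exists v, w.
by exists (SigSub h).
Qed.

(** The image of a path, filled in by [concat], is a path whose limits are [eta]-apart, so it has
    [tau]-mass at least 1. Each of its edges is charged to a near edge of the original path. *)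
Lemma pulled_crossing (eta : R) (P : Z -> Z -> Prop) :
  (forall a b, P a b -> exists2 eps, 0 < eps & forall x y,
    bdist x a < eps -> bdist y b < eps -> eta <= rho (F x) (F y)) ->
  crossing tau (fun a b => eta <= mdist a b) -> crossing pulled P.
Proof.
move=> hP htau v e a b ve /(path_cvgP z0) va /(path_cvgP z0) vb ab.
pose vR k := v k%:Z; pose vL k := v (- k%:Z).
have step k : (gd (F (v k)) (F (v (k + 1)%R)) <= 2 * L)%N.
  have [le _] := qF (v k) (v (k + 1)); apply: leq_trans le _.
  have [_ /gd_adj] := ve k; nia.
have NegzS n : Negz n + 1 = - n%:Z by lia.
have stepR k : (gd ((F \o vR) k) ((F \o vR) k.+1) <= 2 * L)%N.
  by have := step (Posz k); rewrite -PoszD addn1.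
have stepL k : (gd ((F \o vL) k) ((F \o vL) k.+1) <= 2 * L)%N.
  by have := step (Negz k); rewrite NegzS gdC.
have [uR [iR [uR0 uRadj uRnear uRunb uRsum]]] := concat filling_nbr stepR.
have [uL [iL [uL0 uLadj uLnear uLunb uLsum]]] := concat filling_nbr stepL.
have [b' wRb] := image_tends qF vb; have [a' wLa] := image_tends qF va.
have unb (i : nat -> nat) : (forall m, (m <= N * (i m).+1)%N) ->
    forall k, exists n, forall m, (n <= m)%N -> (k <= i m)%N.
  move=> hi k; exists (N * k.+1)%N => m nm.
  by have := leq_trans nm (hi m); rewrite leq_pmul2l.
have uRb := tends_near Z_le1 wRb uRnear (unb _ uRunb).
have uLa := tends_near Z_le1 wLa uLnear (unb _ uLunb).
have sep : eta <= mdist a' b'.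
  have [eps eps0 hsep] := hP a b ab.
  apply/ler_addgt0Pr => d d0; have d20 : 0 < d / 2 by rewrite divr_gt0.
  have [n1 h1] := va _ eps0; have [n2 h2] := vb _ eps0.
  have [n3 h3] := wLa _ d20; have [n4 h4] := wRb _ d20.
  pose n := maxn (maxn n1 n2) (maxn n3 n4).
  have := hsep _ _ (h1 n ltac:(lia)) (h2 n ltac:(lia)).
  have := h3 n ltac:(lia); have := h4 n ltac:(lia).
  have := mdist_bdist z0 (F (vL n)) (F (vR n)) a' b'.
  rewrite /= /vL /vR; lra.
(* The two rays share their initial vertex, and [Negz n] is [-(n + 1)], whence the shift. *)
pose u k := match k with Posz n => uR n | Negz n => uL n.+1 end.
have uN n : u (- n%:Z) = uL n.
  by case: n => [|n] //; rewrite oppr0 /= uL0 uR0 /= /vL oppr0.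
have uadj k : adj (u k) (u (k + 1)).
  case: k => n; first by rewrite -PoszD addn1; exact: uRadj.
  by rewrite NegzS uN; apply: adj_sym; exact: uLadj.
have /choice[e' he'] := fun k => adj_edge (uadj k).
have := htau u e' a' b' (fun k => conj (he' k) (uadj k)).
have -> : (fun k : nat => u (- k%:Z)) = uL by apply/funext => n; exact: uN.
move=> /(_ (proj2 (path_cvgP z0 _ _) uLa) (proj2 (path_cvgP z0 _ _) uRb) sep).
move=> /le_trans; apply.
rewrite !esum_int; [|by move=> k; rewrite lee_fin ?pulled_ge0 ..].
pose S e := sup [set tau e' | e' in near_edge e].
have R1 n : tau (e' (Posz n)) <= S (e (Posz (iR n))).
  apply: sup_tau; exists (vR (iR n)), (uR n); split; last exact: uRnear.
    by have [-> _] := ve (Posz (iR n)); left.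
  by rewrite he'; left.
have L1 n : tau (e' (Negz n)) <= S (e (Negz (iL n))).
  apply: sup_tau; exists (vL (iL n)), (uL n); split; last exact: uLnear.
    by have [-> _] := ve (Negz (iL n)); right; rewrite NegzS.
  by rewrite he' NegzS uN; right.
apply: leeD; apply: nneseries_le_partial => [//|n|m].
- exact: pulled_ge0.
- exists (iR m).+1; apply: le_trans (uRsum R (fun n => S (e (Posz n))) _ m).
    by apply: ler_sum => n _; exact: R1.
  by move=> k; exact: sup_ge0.
- exact: pulled_ge0.
- exists (iL m).+1; apply: le_trans (uLsum R (fun n => S (e (Negz n))) _ m).
    by apply: ler_sum => n _; exact: L1.
  by move=> k; exact: sup_ge0.
Qed.

End pulled.

End pullback.

(** * Quasi-isometries from the group action *)

Lemma compact_bounded (R : realType) (Y : metricType R) (K : set Y) (y0 : Y) :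
  compact K -> exists M, forall y, K y -> mdist y0 y <= M.
Proof.
move=> cK; apply: contrapT => nb.
have /choice[k hk] : forall n : nat, exists y, K y /\ n%:R < mdist y0 y.
  move=> n; apply: contrapT => ny; apply: nb; exists n%:R => y Ky.
  by rewrite leNgt; apply/negP => lt; apply: ny; exists y.
have FK : (k @ \oo) K by exists 0%N => // n _; have [] := hk n.
have [z [_ zc]] := cK (k @ \oo) _ FK.
pose N := Num.bound (mdist y0 z + 1).
have A : (k @ \oo) [set k n | n in [set n | (N <= n)%N]].
  by exists N => // n /= Nn; exists n.
have [_ [[n Nn <-]]] := zc _ _ A (nbhsx_ballx z _ (@ltr01 R)).
rewrite ballEmdist /= => zn; have [_ lt] := hk n.
have := metric_triangle y0 z (k n).
have : mdist y0 z + 1 < N%:R by apply: archi_boundP; rewrite addr_ge0 ?mdist_ge0.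
have : N%:R <= n%:R :> R by rewrite ler_nat.
lra.
Qed.

Section group_action.
Variables (R : realType) (G : graph) (root : G) (Y : metricType R).
Hypothesis GY : quasi_isometric (realization R G) Y.
Variable H : set (Y -> Y).
Hypotheses (H_group : isometry_subgroup H) (H_cocompact : cocompact_action H).

(* Conjugating isometries of [Y] by a quasi-isometry gives self-maps of the
   graph that move any vertex close to [root], with uniform constants. *)
Lemma cocompact_qie : exists L, forall o : G, exists F F' : G -> G,
  [/\ qie L F, qie L F', forall v, (gd (F' (F v)) v <= L)%N & (gd (F o) root <= L)%N].
Proof.
have [f [C [D [C0 D0 hf fD]]]] := GY; have [K cK KY] := H_cocompact.
have [HI _ _ Hinv] := H_group.
pose phi v := f (vpoint R v).
have phiL v w : (gd v w)%:R <= C * (mdist (phi v) (phi w) + D).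
  have /andP[le _] := hf (vpoint R v) (vpoint R w).
  by rewrite -ler_pdivrMl // -lerBlDr -gdist_vpoint.
have phiU v w : mdist (phi v) (phi w) <= C * (gd v w)%:R + D.
  by have /andP[_ le] := hf (vpoint R v) (vpoint R w); rewrite -gdist_vpoint.
(* A coarse inverse of [phi]: passing from a point of the realization to a vertex within distance 1
   costs [C + D]. *)
have /choice[psi hpsi] : forall y, exists v, mdist (phi v) y <= C + 2 * D.
  move=> y; have [x xy] := fD y; have [v xv] := gdist_near_vpoint x; exists v.
  have /andP[_ le] := hf x (vpoint R v).
  have := metric_triangle (phi v) (f x) y; rewrite (metric_sym (phi v) (f x)).
  have : C * mdist x (vpoint R v) <= C by rewrite ler_piMr // ltW.
  rewrite /phi; lra.
have [M hM] := compact_bounded (phi root) cK.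
pose E := C + 2 * D.
(* The summands bound the multiplicative constant, the additive error (also that of [F' (F v)]), and
   the distance from [F o] to [root]. *)
pose B := C * C + C * (2 * E + 2 * D) + C * (E + `|M| + D).
pose L := Num.bound B.
have E0 : 0 < E by rewrite addr_gt0 // mulr_gt0.
have CC : 0 < C * C by rewrite mulr_gt0.
have CE : 0 < C * (2 * E + 2 * D) by rewrite mulr_gt0 // addr_gt0 // mulr_gt0.
have CM : 0 <= C * (E + `|M| + D).
  apply: mulr_ge0; [exact: ltW|apply: addr_ge0; [|exact: ltW]].
  by apply: addr_ge0 => //; exact: ltW.
have LB : B < L%:R.
  by apply: archi_boundP; apply: addr_ge0 => //; apply: addr_ge0; exact: ltW.
exists L.
have natL (n m : nat) : n%:R <= C * C * m%:R + C * (2 * E + 2 * D) -> (n <= L * m + L)%N.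
  move=> le; rewrite -(ler_nat R) natrD natrM; apply: le_trans le _.
  apply: lerD; last by rewrite /B in LB; lra.
  by rewrite ler_wpM2r //; rewrite /B in LB; lra.
have qieF g : H g -> qie L (psi \o g \o phi).
  move=> /HI[_ giso] v w; rewrite /=; set v' := psi _; set w' := psi _.
  have h1 := hpsi (g (phi v)); have h2 := hpsi (g (phi w)).
  rewrite -/v' -/w' -/E in h1 h2; have iso := giso (phi v) (phi w).
  split; apply: natL.
    apply: le_trans (phiL v' w') _.
    have le : mdist (phi v') (phi w') <= 2 * E + mdist (phi v) (phi w).
      have := metric_triangle (phi v') (g (phi v)) (phi w').
      have := metric_triangle (g (phi v)) (g (phi w)) (phi w').
      by rewrite (metric_sym (g (phi w))); lra.
    have le2 := phiU v w; rewrite -mulrA -mulrDr ler_pM2l //; lra.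
  apply: le_trans (phiL v w) _.
  have le : mdist (phi v) (phi w) <= 2 * E + mdist (phi v') (phi w').
    have := metric_triangle (g (phi v)) (phi v') (g (phi w)).
    have := metric_triangle (phi v') (phi w') (g (phi w)).
    by rewrite (metric_sym (g (phi v)) (phi v')); lra.
  have le2 := phiU v' w'; rewrite -mulrA -mulrDr ler_pM2l //; lra.
move=> o; have : [set: Y] (phi o) by [].
(* The inverse [g] of [g0] brings [phi o] into [K], so [F] is built from [g] and [F'] from [g0]. *)
rewrite KY => -[g0 Hg0 [k Kk gk]]; have [g [Hg g0K gK]] := Hinv _ Hg0.
exists (psi \o g \o phi), (psi \o g0 \o phi); split; [exact: qieF|exact: qieF| |].
  move=> v; rewrite -(ler_nat R) /=; set v' := psi (g _); set v'' := psi _.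
  have h1 : mdist (phi v') (g (phi v)) <= E by exact: hpsi.
  have h2 : mdist (phi v'') (g0 (phi v')) <= E by exact: hpsi.
  have [_ iso] := HI _ Hg0; have := iso (phi v') (g (phi v)); rewrite gK => h3.
  have := phiL v'' v; have := metric_triangle (phi v'') (g0 (phi v')) (phi v) => h4.
  have : C * (mdist (phi v'') (phi v) + D) <= C * (2 * E + 2 * D).
    by rewrite ler_pM2l //; lra.
  rewrite /B in LB; lra.
rewrite -(ler_nat R) /=; set o' := psi (g _).
have h1 : mdist (phi o') (g (phi o)) <= E by exact: hpsi.
have := phiL o' root; have := metric_triangle (phi o') (g (phi o)) (phi root).
have := hM k Kk; rewrite -gk g0K in h1 *; rewrite (metric_sym k) => h2 h3.
have h4 := ler_norm M.
have : C * (mdist (phi o') (phi root) + D) <= C * (E + `|M| + D).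
  by rewrite ler_pM2l //; lra.
rewrite /B in LB; lra.
Qed.

End group_action.

(** * Gromov products at the location and scale of a set *)

Section cross_ratio.
Variables (R : realType) (Z : metricType R) (X : hyperbolic_filling Z) (z0 : Z).
Hypothesis Z_le1 : forall x y : Z, mdist x y <= 1.
Local Notation s := (scaling X).
Local Notation V := (filling_graph X).
Local Notation lev := (@vlevel R Z X).
Local Notation root := (None : V).
Local Notation rho := (@rho R Z X z0).
Local Notation bdist := (@bdist R Z X z0).
Local Notation q := (sqrt_scaling X).

(* The Gromov product based at [o] is the logarithm of a cross-ratio. *)
Lemma cross_ratio : exists2 C, 0 < C & forall o x y,
  q ^+ dprod o x y * rho x y <= C * s ^+ lev o * rho o x * rho o y.
Proof.
have [C C0 hC] := rho_upper X z0 Z_le1; have q0 : 0 < q by exact: lt_trans (q_gt1 X).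
exists (C * q ^+ 6); first by rewrite mulr_gt0 // exprn_gt0.
move=> o x y.
(* An exact identity of exponents, in which [gd o x] and [gd o y] cancel. *)
have key : q ^+ dprod o x y * q ^+ dprod root o x * q ^+ dprod root o y =
    s ^+ lev o * q ^+ dprod root x y.
  rewrite -q_sqr -exprM -!exprD; congr (_ ^+ _).
  have := dprod_root z0 Z_le1 o x; have := dprod_root z0 Z_le1 o y.
  have := dprod_root z0 Z_le1 x y; have := gd_tri o x y.
  by rewrite /dprod (gdC x o); lia.
have := rho_lower z0 Z_le1 o x; have := rho_lower z0 Z_le1 o y.
have := hC x y; have := rho_gt0 z0 x y; have := rho_gt0 z0 o x; have := rho_gt0 z0 o y.
have : 0 < q ^+ dprod o x y by rewrite exprn_gt0.
have : 0 < s ^+ lev o by rewrite exprn_gt0 // (lt_trans _ (scaling_gt1 X)).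
have : 0 < q ^+ 3 by rewrite exprn_gt0.
rewrite (exprM q 3 2) expr2.
move: (rho x y) (rho o x) (rho o y) => xy ox oy.
move: (q ^+ dprod o x y) (q ^+ dprod root o x) (q ^+ dprod root o y) key => Po Pox Poy.
move: (q ^+ dprod root x y) (s ^+ lev o) (q ^+ 3) => Pxy S Q key.
move=> Q0 S0 Po0 oy0 ox0 xy0 le1 le2 le3.
apply: (@le_trans _ _ (Po * xy * (Q * oy * Poy * (Q * ox * Pox)))).
  rewrite ler_peMr ?mulr_ge0 ?(ltW Po0) ?(ltW xy0) //; exact: mulr_ege1.
have -> : Po * xy * (Q * oy * Poy * (Q * ox * Pox)) =
  Q * Q * ox * oy * xy * (Po * Pox * Poy) by ring.
rewrite key.
have -> : Q * Q * ox * oy * xy * (S * Pxy) = Q * Q * ox * oy * S * (xy * Pxy) by ring.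
have -> : C * (Q * Q) * S * ox * oy = Q * Q * ox * oy * S * C by ring.
by rewrite ler_pM2l // !mulr_gt0.
Qed.

(** For [o] near [a0] at scale [r], [rho o x] is comparable to at most [s ^- lev o], and [rho o y]
    to at most [rho x y], so the cross-ratio is bounded. *)
Lemma far_dprod : exists n, forall (A : set Z) (r : R), 0 < r -> r <= 1 -> forall a0, A a0 ->
  (forall a a', A a -> A a' -> mdist a a' <= r) ->
  exists o : V, forall a b, A a -> r <= mdist a b -> exists2 eps, 0 < eps &
    forall x y, bdist x a < eps -> bdist y b < eps -> (dprod o x y <= n)%N.
Proof.
have [C C0 hC] := cross_ratio; have q1 := q_gt1 X; have s1 := scaling_gt1 X.
have s0 : 0 < s by exact: lt_trans s1.
have [n hn] := exprn_unbounded (C * 4 * (8 * s + 1)) q1.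
exists n => A r r0 r1 a0 Aa0 diamA.
have [k kr rk] : exists2 k, s ^- k.+1 < r & r <= s ^- k.
  have ex : exists m, s ^- m < r.
    have [m hm] := exprn_unbounded (r^-1 + 1) s1; exists m.
    by rewrite invf_plt ?posrE ?exprn_gt0 //; apply: lt_le_trans hm; rewrite ltrDl.
  case: (ex_minnP ex) => -[|k] hk mink; first by move: hk; rewrite expr0 invr1 ltNge r1.
  by exists k => //; rewrite leNgt; apply/negP => /mink; rewrite ltnn.
have [ o [ok oa]] := vertex_near X z0 Z_le1 k a0; exists o => a b Aa ab.
(* Two errors of [r / 4] leave [rho x y] at least [r / 2]. *)
exists (r / 4); first by rewrite divr_gt0.
move=> x y xa yb.
have ox : rho o x <= 4 * s ^- k.
  have := mdist_bdist z0 o x a0 a; have := diamA _ _ Aa0 Aa.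
  have : bdist o a0 <= 2 * s ^- k by rewrite /bdist ok; lra.
  lra.
have xy : r / 2 <= rho x y.
  have := metric_triangle a (cen z0 x) b; have := metric_triangle (cen z0 x) (cen z0 y) b.
  rewrite (metric_sym a (cen z0 x)) => h1 h2.
  have := powN_gt0 X (lev x); have := powN_gt0 X (lev y).
  by move: xa yb; rewrite /bdist /rho; lra.
have skr : s ^- k <= s * r.
  have : s * s ^- k.+1 <= s * r by rewrite ler_pM2l // ltW.
  by rewrite exprS invfM mulrA mulfV ?mul1r // gt_eqF.
have xy0 := rho_gt0 z0 x y.
have oy : rho o y <= (8 * s + 1) * rho x y.
  have := rho_tri z0 x o y; have : s * r <= s * (2 * rho x y) by rewrite ler_pM2l //; lra.
  rewrite mulrDl; lra.
rewrite -(ler_eXn2l q1); apply: le_trans hn.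
rewrite -(ler_pM2r xy0); apply: le_trans (hC o x y) _.
rewrite ok.
apply: (@le_trans _ _ (C * s ^+ k * (4 * s ^- k) * ((8 * s + 1) * rho x y))).
  apply: ler_pM => //.
  - by rewrite !mulr_ge0 // ?(ltW C0) ?exprn_ge0 ?(ltW s0) ?(ltW (rho_gt0 _ _ _)).
  - exact: ltW (rho_gt0 _ _ _).
  - by rewrite ler_wpM2l // mulr_ge0 // ?(ltW C0) ?exprn_ge0 ?(ltW s0).
rewrite le_eqVlt; apply/orP; left; apply/eqP; field.
by rewrite expf_eq0 gt_eqF ?andbF.
Qed.

End cross_ratio.

(** * The sets of exponents *)

Section distances.
Context {R : realType} {Z : metricType R}.
Implicit Types A B : set Z.

Lemma mdist_le_diam A (x y : Z) : (forall a b : Z, mdist a b <= 1) ->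
  A x -> A y -> mdist x y <= diam A.
Proof.
move=> le1 Ax Ay; apply: ub_le_sup; last by exists (x, y).
by exists 1 => _ [ab _ <-].
Qed.

Lemma diam_le A r : A !=set0 -> (forall a b, A a -> A b -> mdist a b <= r) -> diam A <= r.
Proof.
move=> [x Ax] h; apply: ge_sup; first by exists (mdist x x), (x, x).
by move=> _ [[a b] [Aa Ab] <-]; exact: h.
Qed.

Lemma setdist_le A B a b : A a -> B b -> setdist A B <= mdist a b.
Proof.
move=> Aa Bb; apply: ge_inf; last by exists (a, b).
by exists 0 => _ [ab _ <-]; exact: mdist_ge0.
Qed.

Lemma setdist_ge A B r : A !=set0 -> B !=set0 ->
  (forall a b, A a -> B b -> r <= mdist a b) -> r <= setdist A B.
Proof.
move=> [a Aa] [b Bb] h; apply: lb_le_inf; first by exists (mdist a b), (a, b).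
by move=> _ [[x y] [Ax By] <-]; exact: h.
Qed.

Lemma setdistC A B : setdist A B = setdist B A.
Proof.
by congr inf; apply/seteqP; split=> _ [[x y] [/= ? ?] <-]; exists (y, x) => //=;
  exact: metric_sym.
Qed.

Lemma setdist_balls (x y : Z) e : 0 < e ->
  mdist x y - 2 * e <= setdist (ball x e) (ball y e).
Proof.
move=> e0; apply: setdist_ge; [by exists x; exact: ballxx|by exists y; exact: ballxx|].
move=> a b; rewrite !ballEmdist /= => xa yb.
have := metric_triangle x a y; have := metric_triangle a b y.
rewrite (metric_sym b y); lra.
Qed.

Lemma diam_eq1 : diam [set: Z] = 1 -> forall x y : Z, mdist x y <= 1.
Proof.
move=> d1 x y.
have [[_ ub]|n] := pselect (has_sup
    [set mdist z.1 z.2 | z in [set: Z] `*` [set: Z]]).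
  by rewrite -d1; apply: ub_le_sup => //; exists (x, y).
by move: d1; rewrite /diam sup_out // => /esym/eqP; rewrite oner_eq0.
Qed.

(** Otherwise [x] would be isolated, and [[set x]], being open and closed, would be all of [Z]. *)
Lemma diam_ball_gt0 (x : Z) e : connected [set: Z] -> diam [set: Z] = 1 -> 0 < e ->
  0 < diam (ball x e).
Proof.
move=> cZ d1 e0; have le1 := diam_eq1 d1.
have [y xy nxy] : exists2 y, mdist x y < e & y != x.
  apply: contrapT => ny; have bx y : mdist x y < e -> y = x.
    by move=> xy; apply/eqP/negPn/negP => nyx; apply: ny; exists y.
  have xZ : [set x] = [set: Z].
    apply: cZ; first by exists x.
      exists (ball x e); first exact: mball_open.
      rewrite setTI ballEmdist; apply/seteqP; split=> [_ ->|y /= /bx //].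
      by rewrite /= mdistxx.
    exists [set x]; last by rewrite setTI.
    rewrite -openC openE => y /= /eqP yx; apply/nbhs_ballP.
    exists (mdist y x) => /=; first by rewrite mdist_gt0.
    by move=> z; rewrite ballEmdist /= => yz zx; move: yz; rewrite zx ltxx.
  move: d1; have : diam [set: Z] <= 0.
    rewrite -xZ; apply: diam_le; first by exists x.
    by move=> _ _ -> ->; rewrite mdistxx.
  by move=> le0 d1; move: le0; rewrite d1 leNgt ltr01.
apply: lt_le_trans (_ : mdist x y <= _); first by rewrite mdist_gt0 eq_sym.
by apply: mdist_le_diam => //; [exact: ballxx|rewrite ballEmdist].
Qed.

End distances.

(** * The two inclusions *)

Section critical_sets.
Variables (R : realType) (Z : metricType R) (X : hyperbolic_filling Z).
Hypotheses (Z_compact : compact [set: Z]) (Z_connected : connected [set: Z]).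
Hypothesis Z_diam : diam [set: Z] = 1.
Local Notation V := (filling_graph X).
Local Notation root := (None : V).
Local Notation bdist := (@bdist R Z X).
Local Notation rho := (@rho R Z X).

Lemma Qw'_set_sub : Qw'_set X `<=` Qw_set X.
Proof.
move=> p [p1 [t0 t00 ctrl]]; split=> // A B [oA oB neA neB dAB].
have p0 : 0 < p by exact: lt_trans p1.
have den : 0 < 4 + 2 * t0 by rewrite addr_gt0 // mulr_gt0.
(* Balls of radius [eps] whose centers satisfy [setdist A B <= mdist x y + 2 * eps] are at least
   [2 * t0 * eps] apart, that is, [t0] times the bound on their diameters. *)
pose eps := setdist A B / (4 + 2 * t0).
have eps0 : 0 < eps by rewrite divr_gt0.
have dE : setdist A B = (4 + 2 * t0) * eps by rewrite mulrC divfK // gt_eqF.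
have [|tau [M [M0 tau0 tauM tauX]]] :=
  @uniform_crossing R Z X p (setdist A B) eps p0 Z_compact eps0.
  move=> x y xy; apply: le_lt_trans ctrl; apply: ereal_sup_ubound.
  exists (ball x eps, ball y eps) => //=; split; try exact: mball_open.
  - by exists x; exact: ballxx.
  - by exists y; exact: ballxx.
  have d2 z : diam (ball z eps) <= 2 * eps.
    apply: diam_le; first by exists z; exact: ballxx.
    move=> a b; rewrite ballEmdist /= => za zb.
    by have := metric_triangle a z b; rewrite (metric_sym a z); lra.
  have m0 : 0 < Num.min (diam (ball x eps)) (diam (ball y eps)).
    by rewrite lt_min !diam_ball_gt0.
  rewrite /reldist ler_pdivlMr //.
  apply: le_trans (setdist_balls x y eps0).
  apply: (@le_trans _ _ (t0 * (2 * eps))); first by rewrite ler_pM2l // ge_min d2.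
  by rewrite dE in xy; lra.
apply: (@le_lt_trans _ _ M%:E); last exact: ltry.
apply: wcap_le tauM _ => // v e a b ve va vb ab; apply: (tauX v e a b ve va vb).
case: ab => -[ha hb]; first exact: setdist_le.
by rewrite metric_sym; exact: setdist_le.
Qed.

Section group.
Variable mu : {outer_measure set Z -> \bar R}.
Hypotheses (mu_regular : borel_regular mu) (mu_ahlfors : ahlfors_regular mu).
Variable Y : metricType R.
Hypothesis XY : quasi_isometric (realization R V) Y.
Variable G : set (Y -> Y).
Hypotheses (G_group : isometry_subgroup G) (G_cocompact : cocompact_action G).

Lemma Qw_set_sub : Qw_set X `<=` Qw'_set X.
Proof.
move=> p [p1 fin]; split=> //; exists 1 => //.
have p0 : 0 < p by exact: lt_trans p1.
have le1 := diam_eq1 Z_diam.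
have [[z0 _]|nZ] := pselect ([set: Z] !=set0); last first.
  apply: (@le_lt_trans _ _ -oo%E); last by [].
  by apply/ereal_supP => y [[A B] [_ _ [a _]]]; case: nZ; exists a.
have [delta hdelta] := filling_hyp X z0 le1.
have [L hL] := cocompact_qie root XY G_group G_cocompact.
have [K hK] := dprod_qie L hdelta.
have [n hn] := far_dprod X z0 le1.
(* [n] bounds the product at [o]; applying [F' \o F] moves three points by at most [L], at cost
   [6 * L]; [dprod_qie] gives [K]; replacing [F o] by the root costs [2 * L]. *)
pose m := (K * (n + 6 * L) + K + 2 * L)%N.
have q0 : 0 < sqrt_scaling X by exact: lt_trans (q_gt1 X).
pose eta := (sqrt_scaling X ^+ (3 + m))^-1.
have eta0 : 0 < eta by rewrite invr_gt0 exprn_gt0.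
(* With this radius the balls of a relevant pair stay at least [eta / 2] apart. *)
have eps0 : 0 < eta / 8 by rewrite divr_gt0.
have [|tau [M [M0 tau0 tauM tauX]]] := @uniform_crossing R Z X p eta (eta / 8) p0 Z_compact eps0.
  move=> x y xy; apply: fin; split; try exact: mball_open.
  - by exists x; exact: ballxx.
  - by exists y; exact: ballxx.
  by apply: lt_le_trans (setdist_balls x y eps0); lra.
have [B tauB] := weak_bound_bounded p0 M0 tauM.
have [N0 hN0] := filling_degree X mu_regular mu_ahlfors Z_compact Z_diam le1 z0.
have [D hD] := gd_ball_cover hN0 (L * (2 * (2 * L).+2 + 1) + L).+1.
pose M' := (D * D).+1%:R * M * (2 * L).+2%:R `^ p.
have M'0 : 0 < M' by rewrite !mulr_gt0 // powR_gt0.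
apply: (@le_lt_trans _ _ M'%:E); last exact: ltry.
apply/ereal_supP => _ [[A1 A2] /= [_ _ neA1 neA2 rel] <-].
have far A A' : 0 < diam A -> diam A <= setdist A A' -> A !=set0 ->
    exists F : V -> V, qie L F /\ forall a b, A a -> A' b -> exists2 eps, 0 < eps &
      forall x y, bdist z0 x a < eps -> bdist z0 y b < eps -> eta <= rho z0 (F x) (F y).
  move=> dA0 dAA' [a0 Aa0].
  have dA1 : diam A <= 1 by apply: diam_le => //; exists a0.
  have dA a a' : A a -> A a' -> mdist a a' <= diam A by exact: mdist_le_diam.
  have [ o ho] := hn A _ dA0 dA1 a0 Aa0 dA.
  have [F [F' [qF qF' FF' Fo]]] := hL o; exists F; split=> // a b Aa A'b.
  have [eps e0 he] := ho a b Aa (le_trans dAA' (setdist_le Aa A'b)).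
  exists eps => // x y xa yb; have lexy := he x y xa yb.
  (* [dprod_qie] bounds products before a map by those after it, so an upper bound after [F] comes
     from its coarse inverse [F']. *)
  have := hK F' qF' (F o) (F x) (F y).
  have := FF' o; have := FF' x; have := FF' y => hy hx ho'.
  have le6 : (dprod (F' (F o)) (F' (F x)) (F' (F y)) <= n + 6 * L)%N.
    apply: leq_trans (dprod_lip o x y _ _ _) _; rewrite leq_add //.
    rewrite -(mulnA 2 3 L) leq_mul2l /= !mulSn addn0 addnA.
    by apply: leq_add; [apply: leq_add|]; rewrite gdC.
  move=> leK; have {leK}lem : (dprod root (F x) (F y) <= m)%N.
    have : (K * dprod (F' (F o)) (F' (F x)) (F' (F y)) <= K * (n + 6 * L))%N.
      by rewrite leq_mul2l le6 orbT.
    move=> le.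
    apply: leq_trans (dprod_lip (F o) (F x) (F y) _ _ _) _.
    rewrite !gdxx !addn0 leq_add ?leq_mul2l //.
    by apply: leq_trans leK _; rewrite leq_add2r.
  rewrite /eta -[leLHS]mul1r ler_pdivrMr ?exprn_gt0 //.
  apply: le_trans (rho_lower z0 le1 (F x) (F y)) _.
  rewrite [sqrt_scaling X ^+ 3 * _]mulrC -mulrA -exprD ler_wpM2l ?(ltW (rho_gt0 _ _ _)) //.
  by rewrite ler_eXn2l ?q_gt1 // leq_add2l.
have pull (F : V -> V) P : qie L F -> (forall a b, P a b -> exists2 eps, 0 < eps &
    forall x y, bdist z0 x a < eps -> bdist z0 y b < eps -> eta <= rho z0 (F x) (F y)) ->
    exists tau' : edge V -> R, [/\ forall e, 0 <= tau' e, weak_bound p M' tau' & crossing tau' P].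
  move=> qF hP; exists (pulled L tau F); split.
  - by move=> e; exact: pulled_ge0.
  - by apply: pulled_weak_bound => //; exact: near_edge_card qF hD.
  - exact: (pulled_crossing le1 Z_compact tau0 tauB qF hP).
have sym (F : V -> V) a b : (exists2 eps, 0 < eps &
    forall x y, bdist z0 x a < eps -> bdist z0 y b < eps -> eta <= rho z0 (F x) (F y)) ->
  exists2 eps, 0 < eps &
    forall x y, bdist z0 x b < eps -> bdist z0 y a < eps -> eta <= rho z0 (F x) (F y).
  by move=> [eps e0 h]; exists eps => // x y xb ya; rewrite rhoC; exact: h.
have diam_ge0 (A : set Z) : A !=set0 -> 0 <= diam A.
  by move=> [a Aa]; have := mdist_le_diam le1 Aa Aa; rewrite mdistxx.
(* Division by zero gives zero, so a relative distance at least 1 forces positive diameters. *)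
have mn0 : 0 < Num.min (diam A1) (diam A2).
  rewrite lt_neqAle le_min !diam_ge0 //= andbT; apply/negP => /eqP e.
  by move: rel; rewrite /reldist -e invr0 mulr0 leNgt ltr01.
move: rel; rewrite /reldist ler_pdivlMr // mul1r => rel.
suff [F [qF hF]] : exists F : V -> V, qie L F /\ forall a b, (A1 a /\ A2 b) \/ (A2 a /\ A1 b) ->
    exists2 eps, 0 < eps &
    forall x y, bdist z0 x a < eps -> bdist z0 y b < eps -> eta <= rho z0 (F x) (F y).
  have [tau' [tau'0 tau'M tau'X]] := pull F _ qF hF.
  exact: wcap_le tau'M tau'X.
move: mn0 rel; case: (leP (diam A1) (diam A2)) => _ mn0 rel.
  have [F [qF hF]] := far A1 A2 mn0 rel neA1; exists F; split=> // a b [[aA bA]|[aA bA]].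
    exact: hF.
  by apply: sym; exact: hF.
rewrite setdistC in rel.
have [F [qF hF]] := far A2 A1 mn0 rel neA2; exists F; split=> // a b [[aA bA]|[aA bA]].
  by apply: sym; exact: hF.
exact: hF.
Qed.

End group.

End critical_sets.

Theorem theorem1p3 (R : realType) (Z : metricType R)
    (mu : {outer_measure set Z -> \bar R})
    (Z_compact : compact [set: Z]) (Z_connected : connected [set: Z])
    (Z_diam : diam [set: Z] = 1)
    (mu_regular : borel_regular mu) (mu_ahlfors : ahlfors_regular mu)
    (X : hyperbolic_filling Z)
    (Y : metricType R)
    (XY : quasi_isometric (realization R (filling_graph X)) Y)
    (G : set (Y -> Y)) (G_group : isometry_subgroup G)
    (G_cocompact : cocompact_action G) :
  Qw X = Qw' X /\ (attained (Qw_set X) -> attained (Qw'_set X)).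
Proof.
have E : Qw_set X = Qw'_set X.
  apply/seteqP; split; last exact: Qw'_set_sub.
  exact: (Qw_set_sub Z_compact Z_diam mu_regular mu_ahlfors XY G_group G_cocompact).
by rewrite /Qw /Qw' E.
Qed.
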